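(* The curves $\{\mathfrak{g}_1(\lambda):\lambda\in\mathbb{R}\}$ and $\{\mathfrak{g}_I(\alpha):\alpha\in\mathbb{R},\ \alpha\neq0\}$ are rigid curves in $\mathcal{N}_7$. Moreover, for any real $r_0\neq0$, the curves $\{\mathfrak{g}_5(r_0,t):t\in\mathbb{R},\ t\neq-1/r_0\}$ and $\{\mathfrak{g}_6(r_0,t):t\in\mathbb{R},\ t\neq0\}$ are rigid curves in $\mathcal{SN}_{7,5}$.
   Context: Let $\mathfrak{g}$ be a real vector space with basis $a,b,c,d,e,f,g$. In structure tables $xy$ denotes the bracket $[x,y]$; brackets of basis elements not listed and not determined by skew-symmetry are zero. For $(r,t)\in\mathbb{R}^2$ define the Lie algebras $\mathfrak{g}_6(r,t)$: $ab=c$, $ac=d$, $ad=e$, $ae=f$, $af=g$, $ag=rg$, $bc=e$, $bd=f$, $be=rtf+(1-t)g$, $bf=rg$, $bg=r^2g$, $cd=-rtf+tg$; $\mathfrak{g}_5(r,t)$: $ab=(1+tr)c$, $ac=d$, $ad=f+tg$, $ae=g$, $af=-rf+g$, $bc=e$, $bd=g$, $be=rd+f$, $ce=g$. Put $\mathfrak{g}_I(\alpha)=\mathfrak{g}_6(0,\alpha)$ and $\mathfrak{g}_1(\lambda)=\mathfrak{g}_5(0,\lambda)$. $\mathcal{N}_7\subset\Lambda^2\mathfrak{g}^*\otimes\mathfrak{g}$ is the variety of all nilpotent Lie algebra structures on $\mathfrak{g}$. $\mathcal{SN}_{7,5}\subset\Lambda^2\mathfrak{g}^*\otimes\mathfrak{g}$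 is the variety of all Lie algebra structures $\mu$ on $\mathfrak{g}$ such that $\mu\big(\mu(x_1,x_2),\mu(\mu(\mu(x_3,x_4),x_5),x_6)\big)=0$ for all $x_1,\dots,x_6\in\mathfrak{g}$ (that is, $[\mathfrak{g}^1,\mathfrak{g}^3]=0$, where $\mathfrak{g}^0=\mathfrak{g}$, $\mathfrak{g}^i=[\mathfrak{g}^{i-1},\mathfrak{g}]$). A curve $\{\mu(t):t\in T\}$ ($T\subset\mathbb{R}$ open) contained in a variety $\mathcal{V}$ of Lie algebra structures on $\mathfrak{g}$ is called a rigid curve in $\mathcal{V}$ if for every $t_0\in T$ there is a neighborhood $U\subset\mathcal{V}$ of $\mu(t_0)$ (in the metric topology of $\mathcal{V}$) such that every $\nu\in U$ is isomorphic to $\mu(t)$ for some $t\in T$. *)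

(* Defs.v *)
From HB Require Import structures.
From mathcomp Require Import all_boot all_order all_algebra.
From mathcomp Require Import all_classical all_reals all_analysis.

Set Implicit Arguments.
Unset Strict Implicit.
Unset Printing Implicit Defensive.

Import Order.TTheory GRing.Theory Num.Theory.
Import numFieldNormedType.Exports.

Local Open Scope classical_set_scope.
Local Open Scope ring_scope.

(* The space g = R^7 is 'rV[R]_7.  A bilinear map g x g -> g is given by its
   structure tensor: mu i j is the bracket of the i-th and j-th vectors of the
   standard basis.  The metric topology is the library's (entrywise) topology
   on matrices. *)
Definition tensor7 (R : realType) := 'M['rV[R]_7]_7.

Section Brackets.
Context {R : realType}.
Implicit Types (mu nu : tensor7 R) (x y z u v : 'rV[R]_7).
Implicit Types (U V W : {vspace 'rV[R]_7}).

Definition lie_br mu x y : 'rV[R]_7 :=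
  \sum_i \sum_j (x 0 i * y 0 j) *: mu i j.

Definition lie_structure mu : Prop :=
  (forall x, lie_br mu x x = 0) /\
  (forall x y z, lie_br mu x (lie_br mu y z) + lie_br mu y (lie_br mu z x)
                 + lie_br mu z (lie_br mu x y) = 0).

Definition lie_isomorphic mu nu : Prop :=
  exists phi : {linear 'rV[R]_7 -> 'rV[R]_7},
    bijective phi /\
    forall x y, phi (lie_br mu x y) = lie_br nu (phi x) (phi y).

(* [U, V], the span of all brackets of U with V; by bilinearity it suffices to
   bracket bases, see br_vspaceP. *)
Definition br_vspace mu U V : {vspace 'rV[R]_7} :=
  <<[seq lie_br mu u v | u <- vbasis U, v <- vbasis V]>>%VS.

Fixpoint lower_central mu (n : nat) : {vspace 'rV[R]_7} :=
  if n is n'.+1 then br_vspace mu (lower_central mu n') fullv else fullv.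

Definition nilpotent_var : set (tensor7 R) :=
  [set mu | lie_structure mu /\ exists n, lower_central mu n = 0%VS].

Definition sn75_var : set (tensor7 R) :=
  [set mu | lie_structure mu /\
     forall x1 x2 x3 x4 x5 x6,
       lie_br mu (lie_br mu x1 x2)
         (lie_br mu (lie_br mu (lie_br mu x3 x4) x5) x6) = 0].

(* A neighborhood of [mu t0] in the variety [X] is one for the induced
   topology, i.e. a set in [within X (nbhs (mu t0))]. *)
Definition rigid_curve (X : set (tensor7 R)) (T : set R)
    (mu : R -> tensor7 R) : Prop :=
  [/\ open T,
      {within T, continuous mu},
      forall t, T t -> X (mu t) &
      forall t0, T t0 -> \forall nu \near within X (nbhs (mu t0)),
        exists2 t, T t & lie_isomorphic nu (mu t)].

Lemma lie_br_is_linear_l mu y : linear (fun x => lie_br mu x y).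
Proof.
move=> k u v; rewrite /lie_br scaler_sumr -big_split; apply: eq_bigr => i _ /=.
rewrite scaler_sumr -big_split; apply: eq_bigr => j _ /=.
by rewrite !mxE mulrDl scalerDl scalerA mulrA.
Qed.

Lemma lie_br_is_linear_r mu x : linear (lie_br mu x).
Proof.
move=> k u v; rewrite /lie_br scaler_sumr -big_split; apply: eq_bigr => i _ /=.
rewrite scaler_sumr -big_split; apply: eq_bigr => j _ /=.
by rewrite !mxE mulrDr scalerDl scalerA mulrCA.
Qed.

HB.instance Definition _ mu x :=
  GRing.isLinear.Build R 'rV[R]_7 'rV[R]_7 *:%R (lie_br mu x)
    (lie_br_is_linear_r mu x).

Lemma lie_br_suml mu n (c : 'I_n -> R) (w : 'I_n -> 'rV[R]_7) y :
  lie_br mu (\sum_i c i *: w i) y = \sum_i c i *: lie_br mu (w i) y.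
Proof.
pose f x := lie_br mu x y.
pose F : {linear 'rV[R]_7 -> 'rV[R]_7} :=
  HB.pack f (GRing.isLinear.Build R _ _ _ f (lie_br_is_linear_l mu y)).
change (F (\sum_i c i *: w i) = \sum_i c i *: F (w i)).
by rewrite linear_sum; apply: eq_bigr => i _; rewrite linearZ.
Qed.

Lemma br_vspaceP mu U V W :
  reflect (forall u v, u \in U -> v \in V -> lie_br mu u v \in W)
          (br_vspace mu U V <= W)%VS.
Proof.
apply: (iffP span_subvP) => [H u v uU vV | H w /allpairsP[[u v] [uU vV ->]]].
  rewrite (coord_vbasis uU) lie_br_suml; apply: memv_suml => i _.
  apply: memvZ; rewrite (coord_vbasis vV) linear_sum.
  apply: memv_suml => j _; rewrite linearZ; apply: memvZ; apply: H.
  by apply/allpairsP; exists ((vbasis U)`_i, (vbasis V)`_j); split=> //=;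
     apply: mem_nth; rewrite size_tuple.
by apply: H; apply: vbasis_mem.
Qed.

(* The tensor of a multiplication table listing the nonzero brackets of basis
   vectors; an entry ((i, j), v) means [e_i, e_j] = v and [e_j, e_i] = - v. *)
Definition of_table (s : seq ('I_7 * 'I_7 * 'rV[R]_7)) : tensor7 R :=
  \matrix_(i, j) \sum_(p <- s)
    (if p.1 == (i, j) then p.2 else if p.1 == (j, i) then - p.2 else 0).

End Brackets.

Definition ixa : 'I_7 := @Ordinal 7 0 isT.
Definition ixb : 'I_7 := @Ordinal 7 1 isT.
Definition ixc : 'I_7 := @Ordinal 7 2 isT.
Definition ixd : 'I_7 := @Ordinal 7 3 isT.
Definition ixe : 'I_7 := @Ordinal 7 4 isT.
Definition ixf : 'I_7 := @Ordinal 7 5 isT.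
Definition ixg : 'I_7 := @Ordinal 7 6 isT.

Section Families.
Context {R : realType}.

Let c : 'rV[R]_7 := delta_mx 0 ixc.
Let d : 'rV[R]_7 := delta_mx 0 ixd.
Let e : 'rV[R]_7 := delta_mx 0 ixe.
Let f : 'rV[R]_7 := delta_mx 0 ixf.
Let g : 'rV[R]_7 := delta_mx 0 ixg.

Definition g6 (r t : R) : tensor7 R := of_table
  [:: ((ixa, ixb), c);
      ((ixa, ixc), d);
      ((ixa, ixd), e);
      ((ixa, ixe), f);
      ((ixa, ixf), g);
      ((ixa, ixg), r *: g);
      ((ixb, ixc), e);
      ((ixb, ixd), f);
      ((ixb, ixe), (r * t) *: f + (1 - t) *: g);
      ((ixb, ixf), r *: g);
      ((ixb, ixg), r ^+ 2 *: g);
      ((ixc, ixd), - (r * t) *: f + t *: g)].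

Definition g5 (r t : R) : tensor7 R := of_table
  [:: ((ixa, ixb), (1 + t * r) *: c);
      ((ixa, ixc), d);
      ((ixa, ixd), f + t *: g);
      ((ixa, ixe), g);
      ((ixa, ixf), - r *: f + g);
      ((ixb, ixc), e);
      ((ixb, ixd), g);
      ((ixb, ixe), r *: d + f);
      ((ixc, ixe), g)].

Definition gI (alpha : R) : tensor7 R := g6 0 alpha.
Definition g1 (lambda : R) : tensor7 R := g5 0 lambda.

End Families.

(* Main.v *)
Require Import Defs.
From HB Require Import structures.
From mathcomp Require Import all_boot all_order all_algebra.
From mathcomp Require Import all_classical all_reals all_analysis.
From mathcomp Require Import ring lra.
Set Implicit Arguments.
Unset Strict Implicit.
Unset Printing Implicit Defensive.
Import Order.TTheory GRing.Theory Num.Theory.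
Import numFieldNormedType.Exports.
Local Open Scope classical_set_scope.
Local Open Scope ring_scope.

(** Why the curves are rigid.  Take a structure nu close to mu(t0) in the given
    variety.  The plan is to rebuild inside nu, out of the two vectors a and b
    alone, the whole basis of the table of mu(t0) by iterated brackets; to show
    that the identities of the variety leave only a few parameters in the
    resulting multiplication table; and to remove all of them but one by a
    change of basis.  Nearness enters only through finitely many strict
    inequalities: some determinant and a few coordinates, continuous in nu, do
    not vanish or keep their sign ([near_adapted6], [near_adapted5],
    [near_adapted1]).

    The lower central series L1, L2, ... does the structural work.  In an algebra
    with [L1, L3] = 0, and in a nilpotent one, it cannot become stationary too
    early ([sn_lc_neq1], [sn_lc_neq2], [nilpotent_lc_neq]); since nearby brackets
    already provide enough independent vectors, counting dimensions determines
    its first terms exactly.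

    Near g6, with X = ad a and Y = ad b on W = L3 = <e, f, g>, the operators X and
    Y commute, e is cyclic for X, and [c, d] is killed by both X and Y.  This
    forces X^2 (X - r) = 0 on W and determines Y from [b, c] = p0 e + p1 f + p2 g
    and from [c, d] = t (g - r f) ([iso_table6]).  A nilpotent algebra satisfies
    the same hypotheses with r = 0 ([structure6_nilpotent]), so both halves of
    the statement about g6 reduce to [table6_normal].  There a -> a + eps b
    makes the values at 0 and at r of P, where [b, c] = P(X) e, coincide (to first
    order when r = 0), a rescaling makes them 1, and a -> a + k c,
    b -> b + k d removes the last coefficient; the latter divides by t, whence
    the condition t <> 0 on the curve.

    Near g5 with r <> 0 the space L3 = <h, A, G>, with h = [a, c] after a
    correction of a, A = [a, h] and G = [c, e], is again a cyclic module
    over the commuting operators ad a and ad b, and G is killed by both.  The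
    Jacobi identity forces the constant term of ad b to vanish, and the table
    [table5] has four parameters.  Scaling and a -> a + k e bring it to the form
    g5(r0, t) ([table5_normal]).

    Near g1 an algebra of the nilpotent variety might have a larger L3.  It would
    then be filiform, which [nilpotent_not_filiform] excludes: the quadratic map
    (p, q) |-> p^2 [a, d] + 2 p q [a, e] + q^2 f would have a value killed by a at
    some (p, q) <> (0, 0), whereas near g1 the g-coordinate of its image under
    ad a is a positive definite form.  Otherwise L3 = <f, g>, and diagonalising
    that quadratic map together with the linear form x |-> [x, f] gives g1(la)
    ([table1_normal]).  The square roots taken in the normalisations exist
    because nearness fixes the signs. *)

(** * Brackets in coordinates and isomorphisms *)

Section Calculus.
Context {R : realType}.
Implicit Types (mu nu : tensor7 R) (x y z u v : 'rV[R]_7).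

Lemma lie_brDr mu x y z : lie_br mu x (y + z) = lie_br mu x y + lie_br mu x z.
Proof. exact: linearD. Qed.

Lemma lie_brZr mu k x y : lie_br mu x (k *: y) = k *: lie_br mu x y.
Proof. exact: linearZ. Qed.

Lemma lie_brNr mu x y : lie_br mu x (- y) = - lie_br mu x y.
Proof. exact: linearN. Qed.

Lemma lie_br0r mu x : lie_br mu x 0 = 0.
Proof. exact: linear0. Qed.

Lemma lie_brDl mu x y z : lie_br mu (x + y) z = lie_br mu x z + lie_br mu y z.
Proof. by have := lie_br_is_linear_l mu z 1 x y; rewrite !scale1r. Qed.

Lemma lie_br0l mu x : lie_br mu 0 x = 0.
Proof. by apply: (addIr (lie_br mu 0 x)); rewrite -lie_brDl !add0r. Qed.

Lemma lie_brZl mu k x y : lie_br mu (k *: x) y = k *: lie_br mu x y.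
Proof.
by have := lie_br_is_linear_l mu y k x 0; rewrite !addr0 lie_br0l addr0.
Qed.

Lemma lie_brNl mu x y : lie_br mu (- x) y = - lie_br mu x y.
Proof. by rewrite -(scaleN1r x) lie_brZl scaleN1r. Qed.

Definition lie_brE := (lie_brDl, lie_brDr, lie_brNl, lie_brNr, lie_brZl,
  lie_brZr, lie_br0l, lie_br0r).

Lemma lie_br_alt_skew mu x y :
  (forall z, lie_br mu z z = 0) -> lie_br mu y x = - lie_br mu x y.
Proof.
move=> alt; apply/eqP; rewrite -addr_eq0; apply/eqP.
by have := alt (x + y); rewrite !lie_brE !alt add0r addr0 addrC.
Qed.

Lemma lie_br_skew mu x y :
  lie_structure mu -> lie_br mu y x = - lie_br mu x y.
Proof. by case=> alt _; exact: lie_br_alt_skew. Qed.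

Lemma lie_br_leibniz mu x y z : lie_structure mu ->
  lie_br mu x (lie_br mu y z) =
  lie_br mu (lie_br mu x y) z + lie_br mu y (lie_br mu x z).
Proof.
move=> mu_lie; have [_ /(_ x y z)] := mu_lie.
rewrite (lie_br_skew (lie_br mu x y) z) // (lie_br_skew x z) // lie_brNr.
by move/eqP; rewrite -addrA addr_eq0 opprD !opprK addrC => /eqP.
Qed.

Lemma lie_br_delta mu i j : lie_br mu (delta_mx 0 i) (delta_mx 0 j) = mu i j.
Proof.
rewrite /lie_br (bigD1 i) //= (bigD1 j) //= !mxE !eqxx mulr1 scale1r.
rewrite big1 ?addr0 => [|k kj]; last first.
  by rewrite !mxE eqxx (negbTE kj) mulr0 scale0r.
rewrite big1 ?addr0 // => k ki; apply: big1 => l _.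
by rewrite !mxE (negbTE ki) mul0r scale0r.
Qed.

Lemma lie_isomorphic_sym mu nu : lie_isomorphic mu nu -> lie_isomorphic nu mu.
Proof.
case=> phi [[psi phiK psiK] phi_br].
have psi_lin : linear psi.
  by move=> k u v; apply: (can_inj phiK); rewrite linearP !psiK.
pose psiL : {linear 'rV[R]_7 -> 'rV[R]_7} :=
  HB.pack psi (GRing.isLinear.Build R _ _ _ psi psi_lin).
exists psiL.
split=> [|x y /=]; first by exists phi.
by apply: (can_inj phiK); rewrite phi_br !psiK.
Qed.

Lemma lie_isomorphic_trans nu mu la :
  lie_isomorphic mu nu -> lie_isomorphic nu la -> lie_isomorphic mu la.
Proof.
move=> [phi [phi_bij phi_br]] [psi [psi_bij psi_br]].
exists (psi \o phi : {linear 'rV[R]_7 -> 'rV[R]_7}).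
by split=> [|x y]; [exact: bij_comp | rewrite /= phi_br psi_br].
Qed.

(** A unit matrix whose rows satisfy in [nu] the relations that the standard
    basis satisfies in [mu] is a change of basis between the two. *)
Lemma lie_isomorphic_mx mu nu (M : 'M[R]_7) : M \in unitmx ->
  (forall x y, lie_br nu (x *m M) (y *m M) = lie_br mu x y *m M) ->
  lie_isomorphic mu nu.
Proof.
move=> M_unit M_br; exists (mulmxr M : {linear 'rV[R]_7 -> 'rV[R]_7}).
split=> [|x y /=]; last by rewrite M_br.
by exists (mulmxr (invmx M)) => x /=; rewrite ?mulmxK ?mulmxKV.
Qed.

Lemma ord7P (P : 'I_7 -> Prop) :
  P ixa -> P ixb -> P ixc -> P ixd -> P ixe -> P ixf -> P ixg -> forall i, P i.
Proof.
move=> Pa Pb Pc Pd Pe Pf Pg [[|[|[|[|[|[|[|//]]]]]]] lti];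
  by rewrite (bool_irrelevance lti isT).
Qed.

Lemma sum7 (V : nmodType) (F : 'I_7 -> V) :
  \sum_i F i = F ixa + (F ixb + (F ixc + (F ixd + (F ixe + (F ixf + F ixg))))).
Proof.
rewrite !big_ord_recl big_ord0 addr0.
by do !congr (_ + _); congr F; apply: val_inj.
Qed.

(** Explicit vectors and matrices, on which identities reduce to polynomial ones. *)
Definition row7 (k0 k1 k2 k3 k4 k5 k6 : R) : 'rV[R]_7 :=
  \row_i [:: k0; k1; k2; k3; k4; k5; k6]`_i.

Definition mx7 v0 v1 v2 v3 v4 v5 v6 : 'M[R]_7 :=
  \matrix_i [:: v0; v1; v2; v3; v4; v5; v6]`_i.

Lemma row7E x : x = row7 (x 0 ixa) (x 0 ixb) (x 0 ixc) (x 0 ixd) (x 0 ixe)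
  (x 0 ixf) (x 0 ixg).
Proof. by apply/rowP; apply: ord7P; rewrite mxE. Qed.

Lemma mulmx_row7 k0 k1 k2 k3 k4 k5 k6 u0 u1 u2 u3 u4 u5 u6 :
  row7 k0 k1 k2 k3 k4 k5 k6 *m mx7 u0 u1 u2 u3 u4 u5 u6 =
  k0 *: u0 + (k1 *: u1 + (k2 *: u2 + (k3 *: u3 + (k4 *: u4 +
    (k5 *: u5 + k6 *: u6))))).
Proof. by apply/rowP => k; rewrite mxE sum7 !mxE. Qed.

Lemma mx7_mul u0 u1 u2 u3 u4 u5 u6 (U : 'M[R]_7) :
  mx7 u0 u1 u2 u3 u4 u5 u6 *m U =
  mx7 (u0 *m U) (u1 *m U) (u2 *m U) (u3 *m U) (u4 *m U) (u5 *m U) (u6 *m U).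
Proof.
apply/row_matrixP; apply: ord7P;
  by apply/rowP => k; rewrite !mxE; apply: eq_bigr => j _; rewrite !mxE.
Qed.

Lemma row7D k0 k1 k2 k3 k4 k5 k6 l0 l1 l2 l3 l4 l5 l6 :
  row7 k0 k1 k2 k3 k4 k5 k6 + row7 l0 l1 l2 l3 l4 l5 l6 =
  row7 (k0 + l0) (k1 + l1) (k2 + l2) (k3 + l3) (k4 + l4) (k5 + l5) (k6 + l6).
Proof. by apply/rowP; apply: ord7P; rewrite !mxE. Qed.

Lemma row7Z k k0 k1 k2 k3 k4 k5 k6 : k *: row7 k0 k1 k2 k3 k4 k5 k6 =
  row7 (k * k0) (k * k1) (k * k2) (k * k3) (k * k4) (k * k5) (k * k6).
Proof. by apply/rowP; apply: ord7P; rewrite !mxE. Qed.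

Lemma delta_row7 :
  ((delta_mx 0 ixa = row7 1 0 0 0 0 0 0) * (delta_mx 0 ixb = row7 0 1 0 0 0 0 0) *
   (delta_mx 0 ixc = row7 0 0 1 0 0 0 0) * (delta_mx 0 ixd = row7 0 0 0 1 0 0 0) *
   (delta_mx 0 ixe = row7 0 0 0 0 1 0 0) * (delta_mx 0 ixf = row7 0 0 0 0 0 1 0) *
   (delta_mx 0 ixg = row7 0 0 0 0 0 0 1))%type.
Proof. by do !split; apply/rowP; apply: ord7P; rewrite !mxE. Qed.

Lemma mx7_unit_lower u0 u1 u2 u3 u4 u5 u6 :
  let M := mx7 u0 u1 u2 u3 u4 u5 u6 in
  (forall i j : 'I_7, (i < j)%N -> M i j = 0) -> (forall i, M i i != 0) ->
  M \in unitmx.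
Proof.
move=> M M_low M_diag; rewrite unitmxE det_trig; last exact/is_trig_mxP.
by rewrite unitfE; apply/prodf_neq0 => i _.
Qed.

Lemma mx7_unit_upper u0 u1 u2 u3 u4 u5 u6 :
  let M := mx7 u0 u1 u2 u3 u4 u5 u6 in
  (forall i j : 'I_7, (j < i)%N -> M i j = 0) -> (forall i, M i i != 0) ->
  M \in unitmx.
Proof.
move=> M M_up M_diag; rewrite -unitmx_tr unitmxE det_trig; last first.
  by apply/is_trig_mxP => i j ij; rewrite mxE M_up.
by rewrite unitfE; apply/prodf_neq0 => i _; rewrite mxE.
Qed.

Lemma mx7_inj v0 v1 v2 v3 v4 v5 v6 k0 k1 k2 k3 k4 k5 k6 :
  mx7 v0 v1 v2 v3 v4 v5 v6 \in unitmx ->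
  k0 *: v0 + (k1 *: v1 + (k2 *: v2 + (k3 *: v3 + (k4 *: v4 +
    (k5 *: v5 + k6 *: v6))))) = 0 ->
  [/\ k0 = 0, k1 = 0, k2 = 0 & k3 = 0] /\ [/\ k4 = 0, k5 = 0 & k6 = 0].
Proof.
set M := mx7 _ _ _ _ _ _ _ => M_unit x_eq0.
pose x := row7 k0 k1 k2 k3 k4 k5 k6.
have xM0 : x *m M = 0 by rewrite mulmx_row7.
have x0E : x = 0 by rewrite -(mulmxK M_unit x) xM0 mul0mx.
have xE i : x 0 i = 0 by rewrite x0E mxE.
by do !split; [have := xE ixa | have := xE ixb | have := xE ixc |
  have := xE ixd | have := xE ixe | have := xE ixf | have := xE ixg]; rewrite mxE.
Qed.

Lemma mx7_free v0 v1 v2 v3 v4 v5 v6 :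
  mx7 v0 v1 v2 v3 v4 v5 v6 \in unitmx -> free [:: v0; v1; v2; v3; v4; v5; v6].
Proof.
move=> M_unit; apply/(@freeP _ _ _ [tuple v0; v1; v2; v3; v4; v5; v6]) => k.
rewrite sum7 /= => /(mx7_inj M_unit)[[? ? ? ?] [? ? ?]]; exact: ord7P.
Qed.

Lemma row_mx7 u0 u1 u2 u3 u4 u5 u6 i :
  row i (mx7 u0 u1 u2 u3 u4 u5 u6) = [:: u0; u1; u2; u3; u4; u5; u6]`_i.
Proof. by apply/rowP => k; rewrite !mxE. Qed.

Lemma lie_br_table (s : seq ('I_7 * 'I_7 * 'rV[R]_7)) x y :
  all (fun p => p.1.1 != p.1.2) s ->
  lie_br (of_table s) x y =
  \sum_(p <- s) (x 0 p.1.1 * y 0 p.1.2 - x 0 p.1.2 * y 0 p.1.1) *: p.2.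
Proof.
rewrite /lie_br => /allP s_off.
transitivity (\sum_i \sum_j \sum_(p <- s) (x 0 i * y 0 j) *:
    (if p.1 == (i, j) then p.2 else if p.1 == (j, i) then - p.2 else 0)).
  by apply: eq_bigr => i _; apply: eq_bigr => j _; rewrite mxE scaler_sumr.
under eq_bigr => i _ do rewrite exchange_big.
rewrite exchange_big /=; apply: eq_big_seq => -[[k l] w] /s_off /= kl.
rewrite pair_big /= (bigD1 (k, l)) //= eqxx (bigD1 (l, k)) /=; last first.
  by rewrite xpair_eqE negb_and eq_sym kl.
rewrite xpair_eqE (negbTE kl) /= eqxx big1 ?addr0; last first.
  case=> i j /= /andP[ij1 ij2].
  rewrite eq_sym (negbTE ij1); case: eqP; rewrite ?scaler0 //.
  by case=> ki li; rewrite ki li eqxx in ij2.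
by rewrite scalerN -scaleNr -scalerDl.
Qed.

Lemma lie_br_table_alt (s : seq ('I_7 * 'I_7 * 'rV[R]_7)) x :
  all (fun p => p.1.1 != p.1.2) s -> lie_br (of_table s) x x = 0.
Proof.
move=> s_off; rewrite lie_br_table // big1 // => p _.
by rewrite mulrC subrr scale0r.
Qed.

(** A Lie algebra is recognised by the brackets [e_i, e_j], i < j, of a basis:
    the two bilinear maps are alternating, so these determine both. *)
Lemma lie_isomorphic_table nu s v0 v1 v2 v3 v4 v5 v6 :
  let M := mx7 v0 v1 v2 v3 v4 v5 v6 in
  (forall x, lie_br nu x x = 0) -> all (fun p => p.1.1 != p.1.2) s ->
  M \in unitmx ->
  (forall i j : 'I_7, (i < j)%N ->
     lie_br nu (row i M) (row j M) = of_table s i j *m M) ->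
  lie_isomorphic nu (of_table s).
Proof.
move=> M nu_alt s_off M_unit nuM; apply: lie_isomorphic_sym.
have tabC i j : of_table s j i = - of_table s i j.
  rewrite -!lie_br_delta !lie_br_table // -sumrN; apply: eq_bigr => p _.
  by rewrite -[RHS]scaleNr; congr (_ *: _); ring.
have nuM' i j : lie_br nu (row i M) (row j M) = of_table s i j *m M.
  case: (ltngtP i j) => [/nuM//|ji|/val_inj <-].
    by rewrite tabC mulNmx -nuM // lie_br_alt_skew.
  by rewrite nu_alt -lie_br_delta lie_br_table_alt ?mul0mx.
apply: (lie_isomorphic_mx M_unit) => x y.
rewrite (mulmx_sum_row x) (mulmx_sum_row y) [in RHS]/lie_br mulmx_suml.
rewrite lie_br_suml; apply: eq_bigr => i _.
rewrite (linear_sum (lie_br nu (row i M))) scaler_sumr mulmx_suml.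
apply: eq_bigr => j _.
by rewrite /= lie_brZr nuM' scalerA -scalemxAl.
Qed.

Lemma lie_isomorphic_row7 mu nu (M : 'M[R]_7) : M \in unitmx ->
  (forall k0 k1 k2 k3 k4 k5 k6 l0 l1 l2 l3 l4 l5 l6,
     lie_br nu (row7 k0 k1 k2 k3 k4 k5 k6 *m M)
               (row7 l0 l1 l2 l3 l4 l5 l6 *m M) =
     lie_br mu (row7 k0 k1 k2 k3 k4 k5 k6) (row7 l0 l1 l2 l3 l4 l5 l6) *m M) ->
  lie_isomorphic mu nu.
Proof.
move=> M_unit M_br; apply: (lie_isomorphic_mx M_unit) => x y.
by rewrite (row7E x) (row7E y).
Qed.

End Calculus.

(** * Tables with parameters and their normal forms *)

Section Tables.
Context {R : realType}.
Let c : 'rV[R]_7 := delta_mx 0 ixc.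
Let d : 'rV[R]_7 := delta_mx 0 ixd.
Let e : 'rV[R]_7 := delta_mx 0 ixe.
Let f : 'rV[R]_7 := delta_mx 0 ixf.
Let g : 'rV[R]_7 := delta_mx 0 ixg.

(** The table of g6(r, t) with [b, c] = p0 e + p1 f + p2 g instead of e.  The
    Jacobi identity forces the other brackets: with X = ad a, [b, d] = X [b, c]
    and [b, e] = X [b, d] - [c, d], and p is the value at X = r of the polynomial
    P with [b, c] = P(X) e. *)
Definition table6 (r p0 p1 p2 t : R) : tensor7 R :=
  let p := p0 + r * (p1 + r * p2) in of_table
  [:: ((ixa, ixb), c);
      ((ixa, ixc), d);
      ((ixa, ixd), e);
      ((ixa, ixe), f);
      ((ixa, ixf), g);
      ((ixa, ixg), r *: g);
      ((ixb, ixc), p0 *: e + p1 *: f + p2 *: g);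
      ((ixb, ixd), p0 *: f + (p1 + r * p2) *: g);
      ((ixb, ixe), (r * t) *: f + (p - t) *: g);
      ((ixb, ixf), (p * r) *: g);
      ((ixb, ixg), (p * r ^+ 2) *: g);
      ((ixc, ixd), - (r * t) *: f + t *: g)].

Lemma table6_br r p0 p1 p2 t x0 x1 x2 x3 x4 x5 x6 y0 y1 y2 y3 y4 y5 y6 :
  let p := p0 + r * (p1 + r * p2) in
  lie_br (table6 r p0 p1 p2 t) (row7 x0 x1 x2 x3 x4 x5 x6)
    (row7 y0 y1 y2 y3 y4 y5 y6) =
  row7 0 0 (x0 * y1 - x1 * y0) (x0 * y2 - x2 * y0)
   ((x0 * y3 - x3 * y0) + p0 * (x1 * y2 - x2 * y1))
   ((x0 * y4 - x4 * y0) + p1 * (x1 * y2 - x2 * y1) + p0 * (x1 * y3 - x3 * y1)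
     + r * t * ((x1 * y4 - x4 * y1) - (x2 * y3 - x3 * y2)))
   ((x0 * y5 - x5 * y0) + r * (x0 * y6 - x6 * y0) + p2 * (x1 * y2 - x2 * y1)
     + (p1 + r * p2) * (x1 * y3 - x3 * y1) + (p - t) * (x1 * y4 - x4 * y1)
     + p * r * (x1 * y5 - x5 * y1) + p * r ^+ 2 * (x1 * y6 - x6 * y1)
     + t * (x2 * y3 - x3 * y2)).
Proof.
move=> p; rewrite /table6 lie_br_table // -/p !big_cons big_nil /=.
by apply/rowP; apply: ord7P; rewrite !mxE /=; ring.
Qed.

(** Under a -> a + k c, b -> b + k d the bracket [b, c] loses k [c, d], while e
    gains k [c, d]; hence the coefficient of g - r f drops by 2 k t. *)
Lemma table6_delta r w t : t != 0 ->
  lie_isomorphic (table6 r 1 (- r * w) w t) (table6 r 1 0 0 t).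
Proof.
move=> t0; apply: lie_isomorphic_sym.
have [k ->] : exists k, w = 2 * t * k by exists (w / (2 * t)); field.
pose m := - k ^+ 2 * t.
apply: (@lie_isomorphic_row7 _ _ _ (mx7 (row7 1 0 k 0 0 0 0) (row7 0 1 0 k 0 0 0)
  (row7 0 0 1 0 0 (- r * m) m) (row7 0 0 0 1 0 0 0)
  (row7 0 0 0 0 1 (- r * (k * t)) (k * t)) (row7 0 0 0 0 0 1 0) (row7 0 0 0 0 0 0 1))).
  apply: mx7_unit_upper; last by apply: ord7P; rewrite !mxE oner_neq0.
  by apply: ord7P; apply: ord7P => //; rewrite !mxE.
move=> *; rewrite !mulmx_row7 !row7Z !row7D !table6_br !mulmx_row7 !row7Z !row7D /m.
congr row7; ring.
Qed.

Lemma table6_scale r p0 w t l m : l != 0 -> m != 0 ->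
  lie_isomorphic (table6 r p0 (- r * (l ^+ 2 * w)) (l ^+ 2 * w) t)
    (table6 (l * r) (m * p0) (- (l * r) * (m * w)) (m * w) (m * t)).
Proof.
move=> l0 m0; apply: lie_isomorphic_sym; pose n := l ^+ 2 * m.
have n0 : n != 0 by rewrite mulf_neq0 ?expf_neq0.
apply: (@lie_isomorphic_row7 _ _ _ (mx7 (row7 l 0 0 0 0 0 0)
  (row7 0 n 0 0 0 0 0) (row7 0 0 (l * n) 0 0 0 0)
  (row7 0 0 0 (l ^+ 2 * n) 0 0 0) (row7 0 0 0 0 (l ^+ 3 * n) 0 0)
  (row7 0 0 0 0 0 (l ^+ 4 * n) 0) (row7 0 0 0 0 0 0 (l ^+ 5 * n)))).
  apply: mx7_unit_upper; last first.
    by apply: ord7P; rewrite !mxE /= ?mulf_neq0 ?expf_neq0.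
  by apply: ord7P; apply: ord7P => //; rewrite !mxE.
move=> *; rewrite !mulmx_row7 !row7Z !row7D !table6_br !mulmx_row7 !row7Z !row7D /n.
congr row7; ring.
Qed.

(** The replacement a -> a + eps b, where eps = s / q and q is the value of P
    at r, multiplies r by 1 + s r.  When q = p0 (1 + s r) ^ 2, the new
    vector [b, c] is p0 e' up to a multiple of g' - r' f', the line killed by
    ad a and ad b.  The matrix lists the new basis: u and v are the coordinates
    on f and g of e' = [a', [a', c]]. *)
Lemma table6_shear r p0 s w t
    (q := p0 * (1 + s * r) ^+ 2)
    (v := 2 * (s / q) * (p0 * s * (2 + s * r)) + (s / q) ^+ 2 * (q ^+ 2 - p0 * t))
    (l := (1 + s * r) * (1 + s / q * t * r)) (p2 := p0 * v + w) :
  q != 0 -> q + s * t * r != 0 ->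
  lie_isomorphic (table6 r p0 (p0 * s * (2 + s * r) - r * p2) p2 t)
    (table6 (r * (1 + s * r)) p0 (- (r * (1 + s * r)) * (w / l)) (w / l) (t / l)).
Proof.
move=> q0 qt0.
have /andP[p0_neq0 m0] : (p0 != 0) && (1 + s * r != 0).
  by move: q0; rewrite /q mulf_eq0 negb_or expf_eq0.
pose u := 2 * (s / q) * p0 + (s / q) ^+ 2 * (p0 * t * r).
apply: (@lie_isomorphic_table _ _ _ (row7 1 (s / q) 0 0 0 0 0)
  (row7 0 1 0 0 0 0 0) (row7 0 0 1 0 0 0 0)
  (row7 0 0 0 1 (s / q * p0) (s / q * (p0 * s * (2 + s * r) - r * p2)) (s / q * p2))
  (row7 0 0 0 0 1 u v)
  (row7 0 0 0 0 0 (1 + s / q * t * r)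
    (u + v * r + s / q * (q - t + u * q * r + v * q * r ^+ 2)))
  (row7 0 0 0 0 0 0 ((1 + s * r) ^+ 4))) => //.
- by move=> x; exact: lie_br_table_alt.
- apply: mx7_unit_upper; last first.
    apply: ord7P; rewrite !mxE /= ?oner_neq0 ?expf_neq0 //.
    have -> : 1 + s / q * t * r = (q + s * t * r) / q by field.
    by rewrite mulf_neq0 ?invr_neq0.
  by apply: ord7P; apply: ord7P => //; rewrite !mxE.
have l0 : (p0 * (1 + s * r) ^+ 2 + s * t * r) != 0 by [].
move=> i j; rewrite -(lie_br_delta (table6 _ _ _ _ _)).
move: i j; do 2!apply: ord7P => //; move=> _; rewrite !delta_row7.
all: rewrite !table6_br !row_mx7 /= ?table6_br ?mulmx_row7 ?row7Z ?row7D.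
all: congr row7; rewrite ?/l ?/p2 ?/u ?/v ?/q.
all: (ring || (field; rewrite ?l0 ?p0_neq0 ?m0 //)).
Qed.

Lemma table6_g6 (r t : R) : table6 r 1 0 0 t = g6 r t.
Proof.
by rewrite /table6 /g6 !mulr0 !addr0 mulr0 addr0 !mul1r !scale1r !scale0r !addr0.
Qed.

(** The equation for s reads p = p0 (1 + s r) ^ 2 when r is nonzero.  Each root
    may make one diagonal entry of the shear vanish, but not both roots do. *)
Lemma table6_normal (r r0 p0 p1 p2 t : R) (p := p0 + r * (p1 + r * p2)) :
  0 < p0 -> 0 < p -> t != 0 -> (r == 0) = (r0 == 0) ->
  exists2 t', t' != 0 & lie_isomorphic (table6 r p0 p1 p2 t) (g6 r0 t').
Proof.
move=> p0_gt0 p_gt0 t0 rr0.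
have p0_neq0 : p0 != 0 by rewrite gt_eqF.
have [s ps sP] : exists2 s, p1 + r * p2 = p0 * s * (2 + s * r) &
    p + s * t * r != 0.
  have [r_eq0|r_neq0] := eqVneq r 0.
    exists (p1 / (2 * p0)); first by rewrite r_eq0; field.
    by rewrite r_eq0 mulr0 addr0 gt_eqF.
  pose z := Num.sqrt (p / p0).
  have z_gt0 : 0 < z by rewrite sqrtr_gt0 divr_gt0.
  have zz : z * z = p / p0 by rewrite -expr2 sqr_sqrtr // ltW // divr_gt0.
  have zP y : y * y = p / p0 ->
      p1 + r * p2 = p0 * ((y - 1) / r) * (2 + (y - 1) / r * r).
    move=> yy; transitivity (p0 * (y * y - 1) / r); last by field.
    by rewrite yy /p; field; rewrite r_neq0.
  (* the roots z and - z cannot both make the diagonal entry vanish *)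
  have [pz|pz] := eqVneq (p + (z - 1) / r * t * r) 0; last first.
    by exists ((z - 1) / r) => //; exact: zP.
  exists ((- z - 1) / r); first by apply: zP; rewrite mulrNN.
  have -> : p + (- z - 1) / r * t * r = p + (z - 1) / r * t * r - 2 * z * t.
    by field.
  by rewrite pz add0r oppr_eq0 !mulf_neq0 // gt_eqF.
have pq : p = p0 * (1 + s * r) ^+ 2 by rewrite /p ps; ring.
have sr0 : 1 + s * r != 0.
  by apply: contraTneq p_gt0 => z; rewrite pq z expr0n mulr0 ltxx.
have [w w_def] : exists w, p2 = p0 * (2 * (s / p) * (p0 * s * (2 + s * r)) +
    (s / p) ^+ 2 * (p ^+ 2 - p0 * t)) + w.
  by eexists; rewrite addrC; apply/esym; exact: subrK.
have p1E : p1 = p0 * s * (2 + s * r) - r * p2 by rewrite -ps addrK.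
set T := table6 _ _ _ _ _.
have [w' [t' t'0 T_iso]] : exists w', exists2 t', t' != 0 &
    lie_isomorphic T (table6 (r * (1 + s * r)) p0 (- (r * (1 + s * r)) * w') w' t').
  pose l := (1 + s * r) * (1 + s / p * t * r).
  exists (w / l); exists (t / l); last first.
    rewrite /T p1E w_def /l pq; apply: table6_shear; first by rewrite -pq gt_eqF.
    by rewrite -pq.
  rewrite mulf_neq0 ?invr_neq0 // mulf_neq0 //.
  have -> : 1 + s / p * t * r = (p + s * t * r) / p by field; rewrite gt_eqF.
  by rewrite mulf_neq0 ?invr_neq0 // gt_eqF.
have [l l0 lr] : exists2 l, l != 0 & l * (r * (1 + s * r)) = r0.
  have [r_eq0|r_neq0] := eqVneq r 0.
    exists 1; rewrite ?oner_neq0 // r_eq0 mul0r mulr0.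
    by apply/esym/eqP; rewrite -rr0 r_eq0.
  exists (r0 / (r * (1 + s * r))).
    by rewrite mulf_neq0 ?invr_neq0 ?mulf_neq0 // -rr0.
  by field; rewrite ?r_neq0 ?sr0.
exists (p0^-1 * t'); first by rewrite mulf_neq0 ?invr_neq0.
apply: (lie_isomorphic_trans T_iso).
have -> : w' = l ^+ 2 * (w' / l ^+ 2) by field.
apply: (lie_isomorphic_trans (table6_scale _ _ _ _ l0 (invr_neq0 p0_neq0))).
rewrite lr mulVf // -table6_g6; apply: table6_delta.
by rewrite mulf_neq0 ?invr_neq0.
Qed.

(** The basis is a, b, c = [a, b], d = [a, c], e = [b, c], f = [a, d],
    g = [c, e]; this differs from the basis of the table of g5, see
    [table5_g5]. *)
Definition table5 (r ga q s : R) : tensor7 R := of_table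
  [:: ((ixa, ixb), c);
      ((ixa, ixc), d);
      ((ixa, ixd), f);
      ((ixa, ixe), ga *: g);
      ((ixa, ixf), - r *: f + q^-1 *: g);
      ((ixb, ixc), e);
      ((ixb, ixd), ga *: g);
      ((ixb, ixe), (q * r) *: d + q *: f + s *: g);
      ((ixc, ixe), g)].

Lemma table5_br r ga q s x0 x1 x2 x3 x4 x5 x6 y0 y1 y2 y3 y4 y5 y6 :
  lie_br (table5 r ga q s) (row7 x0 x1 x2 x3 x4 x5 x6)
    (row7 y0 y1 y2 y3 y4 y5 y6) =
  row7 0 0 (x0 * y1 - x1 * y0)
    ((x0 * y2 - x2 * y0) + q * r * (x1 * y4 - x4 * y1)) (x1 * y2 - x2 * y1)
    ((x0 * y3 - x3 * y0) - r * (x0 * y5 - x5 * y0) + q * (x1 * y4 - x4 * y1))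
    (ga * ((x0 * y4 - x4 * y0) + (x1 * y3 - x3 * y1))
     + q^-1 * (x0 * y5 - x5 * y0) + s * (x1 * y4 - x4 * y1)
     + (x2 * y4 - x4 * y2)).
Proof.
rewrite /table5 lie_br_table // !big_cons big_nil /=.
by apply/rowP; apply: ord7P; rewrite !mxE /=; ring.
Qed.

Lemma g5_br r t x0 x1 x2 x3 x4 x5 x6 y0 y1 y2 y3 y4 y5 y6 :
  lie_br (g5 r t) (row7 x0 x1 x2 x3 x4 x5 x6) (row7 y0 y1 y2 y3 y4 y5 y6) =
  row7 0 0 ((1 + t * r) * (x0 * y1 - x1 * y0))
    ((x0 * y2 - x2 * y0) + r * (x1 * y4 - x4 * y1)) (x1 * y2 - x2 * y1)
    ((x0 * y3 - x3 * y0) - r * (x0 * y5 - x5 * y0) + (x1 * y4 - x4 * y1))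
    (t * (x0 * y3 - x3 * y0) + (x0 * y4 - x4 * y0) + (x0 * y5 - x5 * y0)
     + (x1 * y3 - x3 * y1) + (x2 * y4 - x4 * y2)) :> 'rV[R]_7.
Proof.
rewrite /g5 lie_br_table // !big_cons big_nil /=.
by apply/rowP; apply: ord7P; rewrite !mxE /=; ring.
Qed.

Lemma table5_scale r ga q s l n : l != 0 -> n != 0 -> q != 0 ->
  lie_isomorphic (table5 r ga q s)
    (table5 (l * r) (ga / n) (q * n ^+ 2 / l ^+ 2) (s / l)).
Proof.
move=> l0 n0 q0; apply: lie_isomorphic_sym.
apply: (@lie_isomorphic_row7 _ _ _ (mx7 (row7 l 0 0 0 0 0 0)
  (row7 0 n 0 0 0 0 0) (row7 0 0 (l * n) 0 0 0 0)
  (row7 0 0 0 (l ^+ 2 * n) 0 0 0) (row7 0 0 0 0 (l * n ^+ 2) 0 0)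
  (row7 0 0 0 0 0 (l ^+ 3 * n) 0) (row7 0 0 0 0 0 0 (l ^+ 2 * n ^+ 3)))).
  apply: mx7_unit_upper; last first.
    by apply: ord7P; rewrite !mxE /= ?mulf_neq0 ?expf_neq0.
  by apply: ord7P; apply: ord7P => //; rewrite !mxE.
move=> *; rewrite !mulmx_row7 !row7Z !row7D !table5_br !mulmx_row7 !row7Z !row7D.
congr row7; (ring || (field; rewrite ?l0 ?n0 ?q0 //)).
Qed.

(** The coefficient s is not an invariant: a -> a + k e shifts it and keeps the
    rest of the table. *)
Lemma table5_eta r ga s k :
  lie_isomorphic (table5 r ga 1 s) (table5 r ga 1 (s + 2 * k * r)).
Proof.
apply: lie_isomorphic_sym.
apply: (@lie_isomorphic_row7 _ _ _ (mx7 (row7 1 0 0 0 k 0 0)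
  (row7 0 1 0 0 0 0 0) (row7 0 0 1 (- k * r) 0 (- k) (- k * s))
  (row7 0 0 0 1 0 0 (- 2 * k)) (row7 0 0 0 0 1 0 (- k * r * ga))
  (row7 0 0 0 0 0 1 0) (row7 0 0 0 0 0 0 1))).
  apply: mx7_unit_upper; last by apply: ord7P; rewrite !mxE /= oner_neq0.
  by apply: ord7P; apply: ord7P => //; rewrite !mxE.
move=> *; rewrite !mulmx_row7 !row7Z !row7D !table5_br !mulmx_row7 !row7Z !row7D.
rewrite invr1.
by congr row7; ring.
Qed.

Lemma table5_g5 r t : 1 + t * r != 0 ->
  lie_isomorphic (table5 r (1 + t * r)^-1 1 (- t / (1 + t * r))) (g5 r t).
Proof.
move=> h0; pose h := 1 + t * r.
apply: (@lie_isomorphic_row7 _ _ _ (mx7 (row7 1 0 0 0 0 0 0)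
  (row7 0 1 0 0 0 0 0) (row7 0 0 h 0 0 0 0)
  (row7 0 0 0 h 0 0 0) (row7 0 0 0 0 h 0 0)
  (row7 0 0 0 0 0 h (h * t)) (row7 0 0 0 0 0 0 (h ^+ 2)))).
  apply: mx7_unit_upper.
    by apply: ord7P; apply: ord7P => //; rewrite !mxE.
  by apply: ord7P; rewrite !mxE /= ?expf_neq0 ?oner_neq0.
move=> *; rewrite !mulmx_row7 !row7Z !row7D table5_br g5_br !mulmx_row7 !row7Z !row7D.
rewrite invr1 /h.
congr row7; (ring || (field; rewrite ?h0 //)).
Qed.

Lemma table5_normal r r0 ga q s : r != 0 -> r0 != 0 -> ga != 0 -> 0 < q ->
  exists2 t, t != - 1 / r0 & lie_isomorphic (table5 r ga q s) (g5 r0 t).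
Proof.
move=> r_neq0 r0_neq0 ga0 q_gt0; pose l := r0 / r; pose z := Num.sqrt q.
have l0 : l != 0 by rewrite mulf_neq0 ?invr_neq0.
have z_gt0 : 0 < z by rewrite sqrtr_gt0.
have zz : q = z ^+ 2 by rewrite sqr_sqrtr // ltW.
have z0 : z != 0 by rewrite gt_eqF.
have n0 : l / z != 0 by rewrite mulf_neq0 ?invr_neq0.
have := table5_scale r ga s l0 n0 (lt0r_neq0 q_gt0).
have -> : l * r = r0 by rewrite /l; field.
have -> : q * (l / z) ^+ 2 / l ^+ 2 = 1 by rewrite zz; field; rewrite ?l0.
set ga' := ga / _; set s' := s / _ => iso1.
have ga'0 : ga' != 0 by rewrite mulf_neq0 ?invr_neq0.
pose t := (ga'^-1 - 1) / r0.
have tE : 1 + t * r0 = ga'^-1 by rewrite /t divfK // addrC subrK.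
exists t.
  apply: contra_neq (invr_neq0 ga'0) => t_eq.
  by rewrite -tE t_eq divfK // addrN.
apply: (lie_isomorphic_trans iso1).
have /(_ (- t / (1 + t * r0)))[k sk] y : exists k, s' + 2 * k * r0 = y.
  by exists ((y - s') / (2 * r0)); field.
apply: (lie_isomorphic_trans (table5_eta r0 ga' s' k)); rewrite sk.
have -> : ga' = (1 + t * r0)^-1 by rewrite tE invrK.
by apply: table5_g5; rewrite tE invr_neq0.
Qed.

(** [a, d], [a, e] = [b, d] and [b, e] are the coefficients of a quadratic map
    in the variables a, b with values in <f, g>; given [b, f], the Jacobi identity
    forces [a, f] and [c, d]. *)
Definition table1 (a1 a2 b1 b2 s : R) : tensor7 R :=
  let rho := 1 + b1 * s in of_table
  [:: ((ixa, ixb), c);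
      ((ixa, ixc), d);
      ((ixa, ixd), a1 *: f + a2 *: g);
      ((ixa, ixe), b1 *: f + b2 *: g);
      ((ixa, ixf), rho *: g);
      ((ixb, ixc), e);
      ((ixb, ixd), b1 *: f + b2 *: g);
      ((ixb, ixe), f);
      ((ixb, ixf), s *: g);
      ((ixc, ixd), (b1 * rho - a1 * s) *: g);
      ((ixc, ixe), g)].

Lemma table1_br a1 a2 b1 b2 s x0 x1 x2 x3 x4 x5 x6 y0 y1 y2 y3 y4 y5 y6 :
  lie_br (table1 a1 a2 b1 b2 s) (row7 x0 x1 x2 x3 x4 x5 x6)
    (row7 y0 y1 y2 y3 y4 y5 y6) =
  row7 0 0 (x0 * y1 - x1 * y0) (x0 * y2 - x2 * y0) (x1 * y2 - x2 * y1)
    (a1 * (x0 * y3 - x3 * y0) + b1 * (x0 * y4 - x4 * y0)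
     + b1 * (x1 * y3 - x3 * y1) + (x1 * y4 - x4 * y1))
    (a2 * (x0 * y3 - x3 * y0) + b2 * (x0 * y4 - x4 * y0)
     + b2 * (x1 * y3 - x3 * y1) + (1 + b1 * s) * (x0 * y5 - x5 * y0)
     + s * (x1 * y5 - x5 * y1)
     + (b1 * (1 + b1 * s) - a1 * s) * (x2 * y3 - x3 * y2)
     + (x2 * y4 - x4 * y2)).
Proof.
rewrite /table1 lie_br_table // !big_cons big_nil /=.
by apply/rowP; apply: ord7P; rewrite !mxE /=; ring.
Qed.

(** Replacing b by b - k a with k = s / rho makes the new b commute with f. *)
Lemma table1_shear_b a1 a2 b1 b2 s (rho := 1 + b1 * s) (k := s / rho)
    (u := 1 - 2 * k * b1 + k ^+ 2 * a1) (v := k ^+ 2 * a2 - 2 * k * b2) :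
  rho != 0 -> u != 0 ->
  lie_isomorphic (table1 a1 a2 b1 b2 s)
    (table1 (a1 / u) ((a2 - a1 / u * v) / (rho * u))
       ((b1 - k * a1) / u)
       ((b2 - k * a2 - (b1 - k * a1) / u * v) / (rho * u)) 0).
Proof.
move=> rho0 u0.
(* rho and s as rational functions of k, which leaves independent variables *)
have [k' kk' [rho' sk']] : exists2 k', k = k' & 1 + b1 * s = (1 - k' * b1)^-1 /\
    s = k' / (1 - k' * b1).
  exists k => //.
  have kb : 1 - k * b1 = rho^-1 by rewrite /k /rho; field.
  by rewrite kb invrK; split=> //; rewrite /k divrK // unitfE.
have kb0 : 1 - k' * b1 != 0.
  by have := rho0; rewrite /rho rho' invr_eq0.
apply: lie_isomorphic_sym.
apply: (@lie_isomorphic_row7 _ _ _ (mx7 (row7 1 0 0 0 0 0 0)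
  (row7 (- k) 1 0 0 0 0 0) (row7 0 0 1 0 0 0 0)
  (row7 0 0 0 1 0 0 0) (row7 0 0 0 (- k) 1 0 0)
  (row7 0 0 0 0 0 u v) (row7 0 0 0 0 0 0 (rho * u)))).
  have -> : mx7 (row7 1 0 0 0 0 0 0) (row7 (- k) 1 0 0 0 0 0) (row7 0 0 1 0 0 0 0)
      (row7 0 0 0 1 0 0 0) (row7 0 0 0 (- k) 1 0 0) (row7 0 0 0 0 0 u v)
      (row7 0 0 0 0 0 0 (rho * u)) =
    mx7 (row7 1 0 0 0 0 0 0) (row7 (- k) 1 0 0 0 0 0) (row7 0 0 1 0 0 0 0)
      (row7 0 0 0 1 0 0 0) (row7 0 0 0 (- k) 1 0 0) (row7 0 0 0 0 0 1 0)
      (row7 0 0 0 0 0 0 1) *m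
    mx7 (row7 1 0 0 0 0 0 0) (row7 0 1 0 0 0 0 0) (row7 0 0 1 0 0 0 0)
      (row7 0 0 0 1 0 0 0) (row7 0 0 0 0 1 0 0) (row7 0 0 0 0 0 u v)
      (row7 0 0 0 0 0 0 (rho * u)) :> 'M[R]_7.
    rewrite mx7_mul !mulmx_row7 !row7Z !row7D.
    by congr mx7; congr row7; ring.
  rewrite unitmx_mul; apply/andP; split.
    apply: mx7_unit_lower; last by apply: ord7P; rewrite !mxE /= oner_neq0.
    by apply: ord7P; apply: ord7P => //; rewrite !mxE.
  apply: mx7_unit_upper; last first.
    by apply: ord7P; rewrite !mxE /= ?mulf_neq0 ?oner_neq0.
  by apply: ord7P; apply: ord7P => //; rewrite !mxE.
move=> *; rewrite !mulmx_row7 !row7Z !row7D !table1_br !mulmx_row7 !row7Z !row7D.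
move: u0; rewrite /u /v kk' /rho rho' sk' => u0.
congr row7.
all: try ring.
all: field; rewrite ?kb0 ?u0 //.
Qed.

(** Diagonalises the quadratic form (a1, b1, 1). *)
Lemma table1_shear_a a1 a2 b1 b2 :
  lie_isomorphic (table1 a1 a2 b1 b2 0)
    (table1 (a1 - b1 ^+ 2) (a2 - 2 * b1 * b2) 0 b2 0).
Proof.
apply: lie_isomorphic_sym.
apply: (@lie_isomorphic_row7 _ _ _ (mx7 (row7 1 (- b1) 0 0 0 0 0)
  (row7 0 1 0 0 0 0 0) (row7 0 0 1 0 0 0 0)
  (row7 0 0 0 1 (- b1) 0 0) (row7 0 0 0 0 1 0 0)
  (row7 0 0 0 0 0 1 0) (row7 0 0 0 0 0 0 1))).
  apply: mx7_unit_upper; last by apply: ord7P; rewrite !mxE /= oner_neq0.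
  by apply: ord7P; apply: ord7P => //; rewrite !mxE.
move=> *; rewrite !mulmx_row7 !row7Z !row7D !table1_br !mulmx_row7 !row7Z !row7D.
by congr row7; ring.
Qed.

Lemma table1_scale a2 b2 k : k != 0 -> b2 != 0 ->
  lie_isomorphic (table1 (k ^- 2) a2 0 b2 0) (g1 (k * a2 / b2)).
Proof.
move=> k0 b20; apply: lie_isomorphic_sym.
apply: (@lie_isomorphic_row7 _ _ _ (mx7 (row7 (k * b2) 0 0 0 0 0 0)
  (row7 0 b2 0 0 0 0 0) (row7 0 0 (k * b2 ^+ 2) 0 0 0 0)
  (row7 0 0 0 (k ^+ 2 * b2 ^+ 3) 0 0 0) (row7 0 0 0 0 (k * b2 ^+ 3) 0 0)
  (row7 0 0 0 0 0 (k * b2 ^+ 4) 0) (row7 0 0 0 0 0 0 (k ^+ 2 * b2 ^+ 5)))).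
  apply: mx7_unit_upper; last first.
    by apply: ord7P; rewrite !mxE /= ?mulf_neq0 ?expf_neq0.
  by apply: ord7P; apply: ord7P => //; rewrite !mxE.
move=> *; rewrite !mulmx_row7 !row7Z !row7D /g1 !table1_br !g5_br.
rewrite !mulmx_row7 !row7Z !row7D.
congr row7; (ring || (field; rewrite ?k0 ?b20 //)).
Qed.

(** The hypothesis b1 ^ 2 < a1 says that the f-component of the quadratic map is
    positive definite; u is the value of that form at b - k a.  The last
    hypothesis says that b2 remains nonzero after the shear of b. *)
Lemma table1_normal a1 a2 b1 b2 s (rho := 1 + b1 * s) (k := s / rho)
    (u := 1 - 2 * k * b1 + k ^+ 2 * a1) (v := k ^+ 2 * a2 - 2 * k * b2) :
  rho != 0 -> b1 ^+ 2 < a1 -> (b2 - k * a2) * u != (b1 - k * a1) * v ->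
  exists t, lie_isomorphic (table1 a1 a2 b1 b2 s) (g1 t).
Proof.
move=> rho0 a1P b2P.
have u_gt0 : 0 < u.
  have -> : u = (1 - k * b1) ^+ 2 + k ^+ 2 * (a1 - b1 ^+ 2) by rewrite /u; ring.
  have [->|k0] := eqVneq k 0; first by rewrite mul0r subr0 expr1n expr0n mul0r addr0.
  by rewrite ltr_wpDl ?sqr_ge0 // mulr_gt0 ?exprn_even_gt0 // subr_gt0.
have u0 : u != 0 by rewrite gt_eqF.
pose a1' := a1 / u; pose b1' := (b1 - k * a1) / u.
pose a2' := (a2 - a1' * v) / (rho * u).
pose b2' := (b2 - k * a2 - b1' * v) / (rho * u).
have iso1 : lie_isomorphic (table1 a1 a2 b1 b2 s) (table1 a1' a2' b1' b2' 0).
  exact: table1_shear_b.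
have a1'P : 0 < a1' - b1' ^+ 2.
  have -> : a1' - b1' ^+ 2 = (a1 - b1 ^+ 2) / u ^+ 2.
    have -> : a1' - b1' ^+ 2 = (a1 * u - (b1 - k * a1) ^+ 2) / u ^+ 2.
      by rewrite /a1' /b1'; field.
    by congr (_ / _); rewrite /u; ring.
  by rewrite divr_gt0 ?exprn_gt0 // subr_gt0.
have b2'0 : b2' != 0.
  rewrite mulf_neq0 ?invr_neq0 ?mulf_neq0 //.
  have -> : b2 - k * a2 - b1' * v = ((b2 - k * a2) * u - (b1 - k * a1) * v) / u.
    by rewrite /b1'; field.
  by rewrite mulf_neq0 ?invr_neq0 // subr_eq0.
pose z := (Num.sqrt (a1' - b1' ^+ 2))^-1.
have z0 : z != 0 by rewrite invr_neq0 // gt_eqF // sqrtr_gt0.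
have zz : a1' - b1' ^+ 2 = z ^- 2 by rewrite exprVn invrK sqr_sqrtr // ltW.
eexists; apply: (lie_isomorphic_trans iso1).
apply: (lie_isomorphic_trans (table1_shear_a _ _ _ _)).
by rewrite zz; apply: table1_scale.
Qed.

End Tables.

(** * The lower central series *)

Section LowerCentral.
Context {R : realType}.
Implicit Types (mu : tensor7 R) (x y z u v w : 'rV[R]_7).

Definition lie_brr mu y x := lie_br mu x y.
HB.instance Definition _ mu y :=
  GRing.isLinear.Build R 'rV[R]_7 'rV[R]_7 *:%R (lie_brr mu y)
    (lie_br_is_linear_l mu y).

Lemma lc_br mu n x y :
  x \in lower_central mu n -> lie_br mu x y \in lower_central mu n.+1.
Proof.
move=> xL; have /br_vspaceP := subvv (lower_central mu n.+1).
by apply=> //; rewrite memvf.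
Qed.

Lemma lc_br_l mu n x y : lie_structure mu ->
  y \in lower_central mu n -> lie_br mu x y \in lower_central mu n.+1.
Proof. by move=> lie yL; rewrite (lie_br_skew y x lie) memvN lc_br. Qed.

(** Membership in a term of the lower central series is used through linear
    images: it suffices to control the image of brackets. *)
Lemma lc_kill mu n (h : {linear 'rV[R]_7 -> 'rV[R]_7}) (W : {vspace 'rV[R]_7}) :
  (forall x y, x \in lower_central mu n -> h (lie_br mu x y) \in W) ->
  forall x, x \in lower_central mu n.+1 -> h x \in W.
Proof.
move=> hL x xL; have hE z : (h z \in W) = (z \in linfun h @^-1: W)%VS.
  by rewrite -memv_preim lfunE.
rewrite hE; apply: subvP xL; apply/br_vspaceP => u v uL _.
by rewrite -hE hL.
Qed.

Lemma lc_sub mu n : (lower_central mu n.+1 <= lower_central mu n)%VS.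
Proof.
elim: n => [|n IHn]; first exact: subvf.
by apply/br_vspaceP => u v uL _; apply: lc_br; apply: (subvP IHn).
Qed.

(** The case i = 1 of [L_i, L_n] <= L_(i + n + 1), from the Jacobi identity. *)
Lemma lc_derived mu n x y : lie_structure mu ->
  x \in lower_central mu 1 -> y \in lower_central mu n ->
  lie_br mu x y \in lower_central mu n.+2.
Proof.
move=> lie xL yL; apply: (@lc_kill mu 0 (lie_brr mu y)) x xL => u v _.
suff : lie_br mu (lie_br mu u v) y \in lower_central mu n.+2 by [].
have -> : lie_br mu (lie_br mu u v) y =
    lie_br mu u (lie_br mu v y) - lie_br mu v (lie_br mu u y).
  by rewrite (lie_br_leibniz u v y lie) addrK.
by apply: rpredB; apply: lc_br_l => //; apply: lc_br_l.
Qed.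

Lemma lc_stable mu n : lower_central mu n.+1 = lower_central mu n ->
  forall m, (n <= m)%N -> lower_central mu m = lower_central mu n.
Proof.
move=> stab; elim=> [|m IHm]; first by rewrite leqn0 => /eqP ->.
by rewrite leq_eqVlt => /predU1P[-> //|/IHm /= ->].
Qed.

(** A Lie algebra whose derived algebra has codimension at most one is spanned
    by the latter and one further vector, whose bracket with itself is zero. *)
Lemma lc_dim1 mu : lie_structure mu ->
  lower_central mu 2 != lower_central mu 1 -> (\dim (lower_central mu 1) <= 5)%N.
Proof.
move=> lie; apply: contraR; rewrite -ltnNge => dimL.
set L1 := lower_central mu 1 in dimL *.
have [x fullE] : exists x, forall u, exists k, u - k *: x \in L1.
  have dimC : (\dim L1^C <= 1)%N.
    by rewrite dimv_compl dimvf /dim /= mul1n leq_subLR addn1.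
  exists (vpick L1^C) => u.
  have : u \in (L1 + L1^C)%VS by rewrite addv_complf memvf.
  case/memv_addP => u1 u1L [u2 u2L ->].
  have : u2 \in <[vpick L1^C]>%VS.
    suff <- : L1^C%VS = <[vpick L1^C]>%VS by [].
    apply/eqP; rewrite eq_sym eqEdim -memvE memv_pick dim_vline vpick0.
    by move: dimC; rewrite -dimv_eq0; case: (\dim _) => [|[|]].
  by case/vlineP => k ->; exists k; rewrite addrK.
apply/eqP; apply: subv_anti; rewrite lc_sub andTb; apply/br_vspaceP => u v _ _.
have [k ku] := fullE u; have [l lv] := fullE v.
have -> : lie_br mu u v = lie_br mu (u - k *: x) v - k *: lie_br mu (v - l *: x) x.
  rewrite !lie_brE (lie_br_skew v x lie) lie.1.
  by apply/rowP => i; rewrite !mxE; ring.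
by rewrite rpredB ?rpredZ //; apply: (@lc_br mu 1).
Qed.

(** A strict inclusion and a dimension count leave no room. *)
Lemma span_maximal (s : seq 'rV[R]_7) (U W : {vspace 'rV[R]_7}) : free s ->
  (<< s >> <= U)%VS -> (U <= W)%VS -> U != W -> (\dim W <= (size s).+1)%N ->
  U = << s >>%VS.
Proof.
move=> s_free sU UW neUW dimW; apply/eqP; rewrite eq_sym eqEdim sU /=.
have ltUW : (\dim U < \dim W)%N by rewrite ltn_neqAle dimvS // dimv_leqif_eq ?neUW.
by move: s_free; rewrite /free => /eqP ->; rewrite -ltnS (leq_trans ltUW).
Qed.

Lemma mem_span_cons x v (s : seq 'rV[R]_7) :
  x \in <<v :: s>>%VS -> exists k y, y \in << s >>%VS /\ x = k *: v + y.
Proof.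
by rewrite span_cons => /memv_addP[_ /vlineP[k ->] [y ys ->]]; exists k, y.
Qed.

Lemma mem_span1 x u : x \in <<[:: u]>>%VS -> exists i, x = i *: u.
Proof. by rewrite span_seq1 => /vlineP. Qed.

Lemma mem_span2 x u v : x \in <<[:: u; v]>>%VS -> exists i j, x = i *: u + j *: v.
Proof. by case/mem_span_cons => i [_ [/mem_span1[j ->] ->]]; exists i, j. Qed.

Lemma mem_span3 x u v w : x \in <<[:: u; v; w]>>%VS ->
  exists i j k, x = i *: u + j *: v + k *: w.
Proof.
case/mem_span_cons => i [_ [/mem_span2[j [k ->]] ->]].
by exists i, j, k; rewrite addrA.
Qed.

Lemma mem_span4 x u v w z : x \in <<[:: u; v; w; z]>>%VS ->
  exists i j k l, x = i *: u + j *: v + k *: w + l *: z.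
Proof.
case/mem_span_cons => i [_ [/mem_span3[j [k [l ->]]] ->]].
by exists i, j, k, l; rewrite !addrA.
Qed.

Lemma span_sub (s : seq 'rV[R]_7) (W : {vspace 'rV[R]_7}) :
  all [in W] s -> (<< s >> <= W)%VS.
Proof. by move=> /allP sW; apply/span_subvP. Qed.

Lemma free_behead v (s : seq 'rV[R]_7) : free (v :: s) -> free s.
Proof. by rewrite free_cons => /andP[]. Qed.

Lemma free_dim (s : seq 'rV[R]_7) : free s -> \dim << s >> = size s.
Proof. by rewrite /free => /eqP. Qed.

(** The start of the lower central series, read off a basis a, ..., g. *)
Lemma lc_flag mu (a b c d e f g : 'rV[R]_7) (L := lower_central mu) :
  lie_structure mu -> mx7 a b c d e f g \in unitmx -> L 2 != L 1 ->
  c \in L 1 -> all [in L 2] [:: d; e; f; g] ->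
  [/\ free [:: c; d; e; f; g], L 1 = <<[:: c; d; e; f; g]>>%VS &
      L 2 = <<[:: d; e; f; g]>>%VS].
Proof.
move=> lie /mx7_free/free_behead/free_behead fr neL cL defgL.
have L1E : L 1 = <<[:: c; d; e; f; g]>>%VS.
  apply/eqP; rewrite eq_sym eqEdim (free_dim fr); apply/andP; split; last first.
    exact: lc_dim1.
  apply: span_sub; rewrite /= cL /=; apply: sub_all defgL => x; exact/subvP/lc_sub.
split=> //; apply: span_maximal (lc_sub mu 1) neL _ => //.
- exact: free_behead fr.
- exact: span_sub.
- by rewrite -/(L 1) L1E (free_dim fr).
Qed.

(** The defining identity of the variety, extended from brackets to the terms of
    the lower central series that they span. *)
Lemma sn_lc mu u w : sn75_var mu ->
  u \in lower_central mu 1 -> w \in lower_central mu 3 -> lie_br mu u w = 0.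
Proof.
case=> lie sn uL wL; apply/eqP; rewrite -memv0.
apply: (@lc_kill mu 0 (lie_brr mu w)) u uL => x1 x2 _.
apply: (@lc_kill mu 2 (lie_br mu (lie_br mu x1 x2))) w wL => v x6 vL.
apply: (@lc_kill mu 1 (lie_br mu (lie_br mu x1 x2) \o lie_brr mu x6)) v vL.
move=> v x5 vL.
apply: (@lc_kill mu 0
  (lie_br mu (lie_br mu x1 x2) \o lie_brr mu x6 \o lie_brr mu x5)) v vL.
by move=> x3 x4 _; rewrite memv0; apply/eqP; exact: sn.
Qed.

(** The two ways in which the lower central series of an algebra of either
    variety is forced to drop. *)
Lemma nilpotent_lc_neq mu n v : nilpotent_var mu ->
  v \in lower_central mu n -> v != 0 ->
  lower_central mu n.+1 != lower_central mu n.
Proof.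
case=> lie [m Lm0] vL; apply: contraNneq => stab.
have [nm|/ltnW mn] := leqP n m.
  by move: vL; rewrite -(lc_stable stab nm) Lm0 memv0.
have Lm1 : lower_central mu m.+1 = lower_central mu m.
  by apply/eqP; rewrite Lm0 -subv0 -[X in (_ <= X)%VS]Lm0 lc_sub.
by move: vL; rewrite (lc_stable Lm1 mn) Lm0 memv0.
Qed.

Lemma sn_lc_neq1 mu u v : sn75_var mu ->
  u \in lower_central mu 1 -> v \in lower_central mu 1 -> lie_br mu u v != 0 ->
  lower_central mu 2 != lower_central mu 1.
Proof.
move=> sn uL vL; apply: contraNneq => stab; apply/eqP; apply: sn_lc => //.
by rewrite (lc_stable stab).
Qed.

Lemma sn_lc_neq2 mu u v : sn75_var mu ->
  u \in lower_central mu 1 -> v \in lower_central mu 2 -> lie_br mu u v != 0 ->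
  lower_central mu 3 != lower_central mu 2.
Proof.
move=> sn uL vL; apply: contraNneq => stab; apply/eqP; apply: sn_lc => //.
by rewrite stab.
Qed.

Lemma lc_full mu x : x \in lower_central mu 0. Proof. exact: memvf. Qed.

End LowerCentral.

(** * Algebras near the family g6 *)

Section StructureSix.
Context {R : realType} (mu : tensor7 R) (lie : lie_structure mu).
Local Notation br := (lie_br mu).
Local Notation L := (lower_central mu).

Lemma shear_b_unit (a b c d e f g : 'rV[R]_7) k :
  mx7 a b c d e f g \in unitmx -> mx7 a (b - k *: a) c d e f g \in unitmx.
Proof.
move=> M_unit.
have -> : mx7 a (b - k *: a) c d e f g =
    mx7 (row7 1 0 0 0 0 0 0) (row7 (- k) 1 0 0 0 0 0) (row7 0 0 1 0 0 0 0)
      (row7 0 0 0 1 0 0 0) (row7 0 0 0 0 1 0 0) (row7 0 0 0 0 0 1 0)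
      (row7 0 0 0 0 0 0 1) *m mx7 a b c d e f g.
  rewrite mx7_mul !mulmx_row7; congr mx7;
    by apply/rowP => i; rewrite !mxE; ring.
rewrite unitmx_mul M_unit andbT; apply: mx7_unit_lower.
  by apply: ord7P; apply: ord7P => //; rewrite !mxE.
by apply: ord7P; rewrite !mxE /= oner_neq0.
Qed.

(** On W = <e, f, g> the operators X = ad a and Y = ad b' commute up to ad c = 0.
    The equations X [c, d] = 0 and Y [c, d] = 0 are all that is left of the
    Jacobi identity: the first gives [c, d] = g2 (g - x2 f - x1 e) and x0 = 0, the
    second has e-coordinate - g0 ^ 2, so that x1 = 0. *)
Lemma iso_table6 (a b c d e f g : 'rV[R]_7) be p0 p1 p2 x0 x1 x2 g0 g1 g2 :
  mx7 a b c d e f g \in unitmx ->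
  br a b = c -> br a c = d -> br a d = e -> br a e = f -> br a f = g ->
  br a g = x0 *: e + x1 *: f + x2 *: g ->
  br b c = be *: d + p0 *: e + p1 *: f + p2 *: g ->
  br c d = g0 *: e + g1 *: f + g2 *: g -> br c d != 0 ->
  [/\ br c e = 0, br c f = 0 & br c g = 0] ->
  [/\ br d e = 0, br d f = 0 & br d g = 0] ->
  [/\ br e f = 0, br e g = 0 & br f g = 0] ->
  [/\ x0 = 0, x1 = 0 &
      exists2 t, t != 0 & lie_isomorphic mu (table6 x2 p0 p1 p2 t)].
Proof.
move=> M_unit ab ac ad ae af ag bc cd cd_neq0 [ce cf cg] [de df dg] [ef eg fg].
have M'_unit := shear_b_unit be M_unit.
have [b' b'_def] : exists b', b' = b - be *: a by exists (b - be *: a).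
rewrite -b'_def in M'_unit.
have indep k0 k1 k2 : k0 *: e + k1 *: f + k2 *: g = 0 -> [/\ k0 = 0, k1 = 0 & k2 = 0].
  move=> k_eq0; have [] // := @mx7_inj _ a b' c d e f g 0 0 0 0 k0 k1 k2 M'_unit.
  by rewrite -k_eq0 !scale0r !add0r addrA.
have ab' : br a b' = c by rewrite b'_def !lie_brE ab lie.1 scaler0 subr0.
have b'c : br b' c = p0 *: e + p1 *: f + p2 *: g.
  rewrite b'_def !lie_brE bc ac.
  by apply/rowP => i; rewrite !mxE; ring.
(* ad a and ad b' commute up to ad c *)
have step x : br a (br b' x) = br c x + br b' (br a x).
  by rewrite (lie_br_leibniz a b' x lie) ab'.
have b'd : br b' d = br a (br b' c) by rewrite step lie.1 ac add0r.
have b'e : br b' e = br a (br b' d) - br c d by rewrite step ad addrC addKr.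
have b'f : br b' f = br a (br b' e) by rewrite step ce ae add0r.
have b'g : br b' g = br a (br b' f) by rewrite step cf af add0r.
have acd : br a (br c d) = 0.
  by rewrite (lie_br_leibniz a c d lie) ac lie.1 ad ce addr0.
have dW k0 k1 k2 : br (k0 *: e + k1 *: f + k2 *: g) d = 0.
  rewrite (lie_br_skew d _ lie) !lie_brE de df dg.
  by rewrite !scaler0 !addr0 oppr0.
have cW k0 k1 k2 : br c (k0 *: e + k1 *: f + k2 *: g) = 0.
  by rewrite !lie_brE ce cf cg !scaler0 !addr0.
have aW k0 k1 k2 : br a (k0 *: e + k1 *: f + k2 *: g) =
    (k2 * x0) *: e + (k0 + k2 * x1) *: f + (k1 + k2 * x2) *: g.
  rewrite !lie_brE ae af ag; by apply/rowP => i; rewrite !mxE; ring.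
have b'cd : br b' (br c d) = 0.
  by rewrite (lie_br_leibniz b' c d lie) b'd b'c aW cW dW addr0.
move: acd; rewrite cd aW => acd.
have [g2x0 g0E g1E] := indep _ _ _ acd.
have g2_neq0 : g2 != 0.
  apply: contraNneq cd_neq0 => g2_0; move: g0E g1E.
  by rewrite cd g2_0 !mul0r !addr0 => -> ->; rewrite !scale0r !addr0.
have x0_0 : x0 = 0 by move/eqP: g2x0; rewrite mulf_eq0 (negbTE g2_neq0) => /eqP.
have comb3 k0 k1 k2 u0 u1 u2 v0 v1 v2 w0 w1 w2 :
    k0 *: (u0 *: e + u1 *: f + u2 *: g) + k1 *: (v0 *: e + v1 *: f + v2 *: g) +
      k2 *: (w0 *: e + w1 *: f + w2 *: g) =
    (k0 * u0 + k1 * v0 + k2 * w0) *: e + (k0 * u1 + k1 * v1 + k2 * w1) *: f +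
      (k0 * u2 + k1 * v2 + k2 * w2) *: g.
  by apply/rowP => i; rewrite !mxE; ring.
have g0_0 : g0 = 0.
  rewrite b'c aW in b'd; rewrite b'd aW cd x0_0 !mulr0 in b'e.
  set u := (X in X *: f) in b'e; set v := (X in X *: g) in b'e.
  have b'eE : br b' e = (- g0) *: e + (u - g1) *: f + (v - g2) *: g.
    by rewrite b'e; apply/rowP => i; rewrite !mxE; ring.
  rewrite b'eE aW x0_0 !mulr0 in b'f; rewrite b'f aW x0_0 !mulr0 in b'g.
  move: b'cd; rewrite cd !lie_brE b'eE b'f b'g comb3 => b'cd.
  have [/eqP] := indep _ _ _ b'cd.
  by rewrite !mulr0 !addr0 mulrN oppr_eq0 -expr2 sqrf_eq0 => /eqP.
have x1_0 : x1 = 0.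
  by move/eqP: g0E; rewrite g0_0 add0r mulf_eq0 (negbTE g2_neq0) => /eqP.
split=> //; exists g2 => //.
have {g1E} g1E : g1 = - (x2 * g2) by apply/eqP; rewrite -addr_eq0 mulrC g1E.
move: ag aW cd b'e; rewrite x0_0 x1_0 g0_0 g1E => ag aW cd b'e.
rewrite b'c aW in b'd; rewrite b'd aW cd in b'e.
have b'eE : br b' e = 0 *: e + (x2 * g2) *: f +
    (p0 + x2 * (p1 + x2 * p2) - g2) *: g.
  by rewrite b'e; apply/rowP => i; rewrite !mxE; ring.
rewrite b'eE aW in b'f; rewrite b'f aW in b'g.
apply: (@lie_isomorphic_table _ _ _ a b' c d e f g) => //; first exact: lie.1.
move=> i j; rewrite -(lie_br_delta (table6 _ _ _ _ _)).
move: i j; do 2!apply: ord7P => //; move=> _; rewrite !delta_row7.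
all: rewrite !row_mx7 /= table6_br mulmx_row7.
all: rewrite ?ab' ?ac ?ad ?ae ?af ?ag ?b'c ?b'd ?b'eE ?b'f ?b'g ?cd.
all: rewrite ?ce ?cf ?cg ?de ?df ?dg ?ef ?eg ?fg.
all: by apply/rowP => i; rewrite !mxE; ring.
Qed.

(** Since [c, d] is nonzero, L2 and L3 are proper, and by dimension
    L3 = <e, f, g>. *)
Lemma structure6_sn (a b c d e f g : 'rV[R]_7) :
  sn75_var mu -> mx7 a b c d e f g \in unitmx ->
  br a b = c -> br a c = d -> br a d = e -> br a e = f -> br a f = g ->
  br c d != 0 ->
  exists be p0 p1 p2 r, [/\ br a g = r *: g,
    br b c = be *: d + p0 *: e + p1 *: f + p2 *: g &
    exists2 t, t != 0 & lie_isomorphic mu (table6 r p0 p1 p2 t)].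
Proof.
move=> sn M_unit ab ac ad ae af cd_neq0.
have cL : c \in L 1 by rewrite -ab; apply/lc_br/lc_full.
have dL : d \in L 2 by rewrite -ac; exact: lc_br_l.
have eL : e \in L 3 by rewrite -ad; exact: lc_br_l.
have sub32 := subvP (lc_sub mu 2); have sub21 := subvP (lc_sub mu 1).
have fL : f \in L 3 by apply: (subvP (lc_sub mu 3)); rewrite -ae lc_br_l.
have gL : g \in L 3 by apply: (subvP (lc_sub mu 3)); rewrite -af lc_br_l.
have [fr L1E L2E] : [/\ free [:: c; d; e; f; g], L 1 = <<[:: c; d; e; f; g]>>%VS &
    L 2 = <<[:: d; e; f; g]>>%VS].
  apply: (lc_flag lie M_unit _ cL) => //; last by rewrite /= dL !sub32.
  by apply: (sn_lc_neq1 sn cL _ cd_neq0); exact: sub21.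
have L3E : L 3 = <<[:: e; f; g]>>%VS.
  apply: (span_maximal _ _ (lc_sub mu 2) (sn_lc_neq2 sn cL dL cd_neq0)).
  - exact: free_behead (free_behead fr).
  - by apply: span_sub; rewrite /= eL fL gL.
  - by rewrite L2E (free_dim (free_behead fr)).
have kill u w : u \in L 1 -> w \in L 3 -> br u w = 0 by exact: sn_lc.
have [x0 [x1 [x2 ag]]] : exists i j k, br a g = i *: e + j *: f + k *: g.
  by apply: mem_span3; rewrite -L3E; apply: (subvP (lc_sub mu 3)); exact: lc_br_l.
have [be [p0 [p1 [p2 bc]]]] : exists i j k l,
    br b c = i *: d + j *: e + k *: f + l *: g.
  by apply: mem_span4; rewrite -L2E lc_br_l.
have [g0 [g1 [g2 cd]]] : exists i j k, br c d = i *: e + j *: f + k *: g.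
  by apply: mem_span3; rewrite -L3E lc_derived // sub21.
have [|||x0_0 x1_0 iso] := iso_table6 M_unit ab ac ad ae af ag bc cd cd_neq0.
- by split; exact: kill.
- by split; apply: kill => //; exact: sub21.
- by split; apply: kill => //; apply: sub21; exact: sub32.
by exists be, p0, p1, p2, x2; rewrite ag x0_0 x1_0 !scale0r !add0r.
Qed.

(** As [L1, L4] is zero, the relations [c, W] = [d, W] = 0 on W = <e, f, g>
    reduce to [c, e] = 0. *)
Lemma structure6_nilpotent (a b c d e f g : 'rV[R]_7) :
  nilpotent_var mu -> mx7 a b c d e f g \in unitmx ->
  br a b = c -> br a c = d -> br a d = e -> br a e = f -> br a f = g ->
  br c d != 0 ->
  exists be p0 p1 p2 t, [/\ br b c = be *: d + p0 *: e + p1 *: f + p2 *: g,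
    t != 0 & lie_isomorphic mu (table6 0 p0 p1 p2 t)].
Proof.
move=> nil M_unit ab ac ad ae af cd_neq0.
have := mx7_free M_unit; rewrite free_cons => /andP[_].
rewrite free_cons => /andP[_ fr5].
have nz x : x \in [:: c; d; e; f; g] -> x != 0 by exact: free_not0.
have cL : c \in L 1 by rewrite -ab; apply/lc_br/lc_full.
have dL : d \in L 2 by rewrite -ac; exact: lc_br_l.
have eL : e \in L 3 by rewrite -ad; exact: lc_br_l.
have fL : f \in L 4 by rewrite -ae; exact: lc_br_l.
have gL : g \in L 5 by rewrite -af; exact: lc_br_l.
have sub54 := subvP (lc_sub mu 4); have sub43 := subvP (lc_sub mu 3).
have sub32 := subvP (lc_sub mu 2); have sub21 := subvP (lc_sub mu 1).
have neL n x : x \in [:: c; d; e; f; g] -> x \in L n -> L n.+1 != L n.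
  by move=> /nz x0 xL; exact: nilpotent_lc_neq nil xL x0.
have [_ L1E L2E] : [/\ free [:: c; d; e; f; g], L 1 = <<[:: c; d; e; f; g]>>%VS &
    L 2 = <<[:: d; e; f; g]>>%VS].
  apply: (lc_flag lie M_unit _ cL); last by rewrite /= dL !sub32 // !sub43 // sub54.
  by apply: (neL _ _ _ cL); rewrite inE eqxx.
have fr4 := free_behead fr5; have fr3 := free_behead fr4.
have fr2 := free_behead fr3; have fr1 := free_behead fr2.
have L3E : L 3 = <<[:: e; f; g]>>%VS.
  apply: (span_maximal fr3 _ (lc_sub mu 2)); last by rewrite L2E (free_dim fr4).
    by apply: span_sub; rewrite /= eL !sub43 // sub54.
  by apply: (neL _ _ _ dL); rewrite !inE eqxx orbT.
have L4E : L 4 = <<[:: f; g]>>%VS.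
  apply: (span_maximal fr2 _ (lc_sub mu 3)); last by rewrite L3E (free_dim fr3).
    by apply: span_sub; rewrite /= fL sub54.
  by apply: (neL _ _ _ eL); rewrite !inE eqxx !orbT.
have L5E : L 5 = <<[:: g]>>%VS.
  apply: (span_maximal fr1 _ (lc_sub mu 4)); last by rewrite L4E (free_dim fr2).
    by apply: span_sub; rewrite /= gL.
  by apply: (neL _ _ _ fL); rewrite !inE eqxx !orbT.
have L6E x : x \in L 6 -> x = 0.
  suff -> : L 6 = 0%VS by rewrite memv0 => /eqP.
  rewrite -span_nil; apply: (span_maximal (nil_free _) _ (lc_sub mu 5)).
  - by rewrite span_nil sub0v.
  - by apply: (neL _ _ _ gL); rewrite !inE eqxx !orbT.
  - by rewrite L5E (free_dim fr1).
have ag : br a g = 0 by apply/L6E/lc_br_l.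
have [be [p0 [p1 [p2 bc]]]] : exists i j k l,
    br b c = i *: d + j *: e + k *: f + l *: g.
  by apply: mem_span4; rewrite -L2E lc_br_l.
have [s [t cd]] : exists i j, br c d = i *: f + j *: g.
  by apply: mem_span2; rewrite -L4E; exact: (lc_derived lie cL dL).
have kill5 x y : x \in L 1 -> y \in L 4 -> br x y = 0.
  by move=> xL yL; apply/L6E/(lc_derived lie).
have ce_s : br c e = s *: g.
  have := lie_br_leibniz a c d lie; rewrite ac lie.1 ad add0r => <-.
  by rewrite cd !lie_brE af ag scaler0 addr0.
have dL1 := sub21 _ dL; have eL1 := sub21 _ (sub32 _ eL).
have fL1 := sub21 _ (sub32 _ (sub43 _ fL)).
have cf : br c f = 0 by exact: kill5.
have cg : br c g = 0 by apply: kill5 => //; exact: sub54.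
have df : br d f = 0 by exact: kill5.
have dg : br d g = 0 by apply: kill5 => //; exact: sub54.
have ef : br e f = 0 by exact: kill5.
have eg : br e g = 0 by apply: kill5 => //; exact: sub54.
have fg : br f g = 0 by apply: kill5 => //; exact: sub54.
have bg : br b g = 0 by apply/L6E/lc_br_l.
have de : br d e = 0.
  have := lie_br_leibniz a c e lie; rewrite ac ae cf addr0 => <-.
  by rewrite ce_s lie_brE ag scaler0.
(* [c, e] = s g, and the Jacobi identity for b', c, d reads -2 s ^ 2 g = 0 *)
have [b' b'_def] : exists b', b' = b - be *: a by exists (b - be *: a).
have ab' : br a b' = c by rewrite b'_def !lie_brE ab lie.1 scaler0 subr0.
have step x : br a (br b' x) = br c x + br b' (br a x).
  by rewrite (lie_br_leibniz a b' x lie) ab'.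
have b'c : br b' c = p0 *: e + p1 *: f + p2 *: g.
  rewrite b'_def !lie_brE bc ac.
  by apply/rowP => i; rewrite !mxE; ring.
have b'd : br b' d = p0 *: f + p1 *: g.
  have := step c; rewrite lie.1 ac add0r => <-.
  by rewrite b'c !lie_brE ae af ag scaler0 addr0.
have b'e : br b' e = - s *: f + (p0 - t) *: g.
  have := step d; rewrite ad => /eqP; rewrite addrC -subr_eq => /eqP <-.
  rewrite b'd cd !lie_brE af ag.
  by apply/rowP => i; rewrite !mxE; ring.
have b'f : br b' f = (- 2 * s) *: g.
  have := step e; rewrite ae => /eqP; rewrite addrC -subr_eq => /eqP <-.
  rewrite b'e ce_s !lie_brE af ag.
  by apply/rowP => i; rewrite !mxE; ring.
have b'g : br b' g = 0 by rewrite b'_def !lie_brE bg ag scaler0 subr0.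
have s0 : s = 0.
  have := lie_br_leibniz b' c d lie; rewrite b'd b'c !lie_brE cf cg cd.
  rewrite (lie_br_skew d e lie) (lie_br_skew d f lie) (lie_br_skew d g lie).
  rewrite de df dg !lie_brE b'f b'g oppr0 !scaler0 !addr0 scalerA => /eqP.
  rewrite scaler_eq0 (negbTE (nz g _)) ?orbF; last by rewrite !inE eqxx !orbT.
  by rewrite mulrCA mulf_eq0 -expr2 sqrf_eq0 oppr_eq0 pnatr_eq0 /= => /eqP.
have ce : br c e = 0 by rewrite ce_s s0 scale0r.
have ag0 : br a g = 0 *: e + 0 *: f + 0 *: g by rewrite ag !scale0r !addr0.
have cd0 : br c d = 0 *: e + s *: f + t *: g by rewrite cd scale0r add0r.
have [//|//|//|_ _ [t' t'0 iso]] :=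
  iso_table6 M_unit ab ac ad ae af ag0 bc cd0 cd_neq0.
by exists be, p0, p1, p2, t'.
Qed.
End StructureSix.

(** * Algebras near the family g5 *)

Section StructureFive.
Context {R : realType} (mu : tensor7 R) (lie : lie_structure mu).
Local Notation br := (lie_br mu).
Local Notation L := (lower_central mu).

(** The hypothesis on the g-coordinate of [c, h] is what places h in L3: as
    [c, L3] = 0 and G = [c, e] has nonzero g-coordinate, it prevents e from
    occurring in [b, e], an element of L3. *)
Lemma structure5_sn (a b c h e A G : 'rV[R]_7) :
  let M := mx7 a b c h e A G in
  sn75_var mu -> M \in unitmx ->
  br a b = c -> br a c = h -> br b c = e -> br a h = A -> br c e = G ->
  br c h 0 ixg = 0 -> G 0 ixg != 0 ->
  (br b e *m invmx M) 0 ixd != 0 -> (br a e *m invmx M) 0 ixg != 0 ->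
  0 < (br a A *m invmx M) 0 ixg ->
  exists r ga q s, [/\ r != 0, ga != 0, 0 < q & lie_isomorphic mu (table5 r ga q s)].
Proof.
move=> M sn M_unit ab ac bc ah ce ch_g G_g be_d ae_g aA_g.
have coordE k0 k1 k2 k3 k4 k5 k6 w i :
    w = row7 k0 k1 k2 k3 k4 k5 k6 *m M ->
    (w *m invmx M) 0 i = row7 k0 k1 k2 k3 k4 k5 k6 0 i.
  by move=> ->; rewrite mulmxK.
have cL : c \in L 1 by rewrite -ab; apply/lc_br/lc_full.
have hL : h \in L 2 by rewrite -ac; exact: lc_br_l.
have eL : e \in L 2 by rewrite -bc; exact: lc_br_l.
have sub32 := subvP (lc_sub mu 2); have sub21 := subvP (lc_sub mu 1).
have sub43 := subvP (lc_sub mu 3).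
have AL : A \in L 3 by rewrite -ah; exact: lc_br_l.
have GL : G \in L 3 by rewrite -ce lc_derived // sub21.
have ce0 : br c e != 0 by rewrite ce; apply: contraNneq G_g => ->; rewrite mxE.
have neL1 : L 2 != L 1 by apply: (sn_lc_neq1 sn cL _ ce0); exact: sub21.
have [fr L1E L2E] : [/\ free [:: c; h; e; A; G], L 1 = <<[:: c; h; e; A; G]>>%VS &
    L 2 = <<[:: h; e; A; G]>>%VS].
  by apply: (lc_flag lie M_unit _ cL); rewrite //= hL eL !sub32.
have kill u w : u \in L 1 -> w \in L 3 -> br u w = 0 by exact: sn_lc.
have CL : br b e \in L 3 by exact: lc_br_l.
have [p [ep [q0 [s0 be]]]] : exists i j k l,
    br b e = i *: h + j *: e + k *: A + l *: G.
  by apply: mem_span4; rewrite -L2E sub32.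
have p0 : p != 0.
  move: be_d; rewrite (@coordE 0 0 0 p ep q0 s0) ?mxE //.
  by rewrite mulmx_row7 be; apply/rowP => i; rewrite !mxE; ring.
have ep0 : ep = 0.
  have := kill c _ cL CL; rewrite be !lie_brE ce (kill _ _ cL AL) (kill _ _ cL GL).
  move/rowP/(_ ixg); rewrite !mxE ch_g !mulr0 add0r !addr0 => /eqP.
  by rewrite mulf_eq0 (negbTE G_g) orbF => /eqP.
have hL3 : h \in L 3.
  have -> : h = p^-1 *: (br b e - q0 *: A - s0 *: G).
    by rewrite be ep0; apply/rowP => i; rewrite !mxE; field.
  by rewrite rpredZ // !rpredB // rpredZ.
have L3E : L 3 = <<[:: h; A; G]>>%VS.
  have fr3 : free [:: h; A; G].
    move: (free_behead fr); rewrite (perm_free (_ : perm_eq _ [:: e; h; A; G])).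
      exact: free_behead.
    by apply/permP => x /=; rewrite addnCA.
  apply: (span_maximal fr3 _ (lc_sub mu 2) (sn_lc_neq2 sn cL eL ce0)).
    by apply: span_sub; rewrite /= hL3 AL GL.
  by rewrite L2E (free_dim (free_behead fr)).
have [be' [al [ga ae]]] : exists i j k, br a e = i *: h + j *: A + k *: G.
  by apply: mem_span3; rewrite -L3E; exact: lc_br_l.
have ga0 : ga != 0.
  move: ae_g; rewrite (@coordE 0 0 0 be' 0 al ga) ?mxE //.
  by rewrite mulmx_row7 ae; apply/rowP => i; rewrite !mxE; ring.
have [x0 [x1 [x2 aA]]] : exists i j k, br a A = i *: h + j *: A + k *: G.
  by apply: mem_span3; rewrite -L3E; apply: sub43; exact: lc_br_l.
have x2_gt0 : 0 < x2.
  move: aA_g; rewrite (@coordE 0 0 0 x0 0 x1 x2) ?mxE //.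
  by rewrite mulmx_row7 aA; apply/rowP => i; rewrite !mxE; ring.
have eh : br h e = 0 by rewrite (lie_br_skew e h lie) kill ?oppr0 // sub21.
have ch : br c h = 0 by exact: kill.
have cA : br c A = 0 by exact: kill.
have cG : br c G = 0 by exact: kill.
have aG : br a G = 0.
  rewrite -ce (lie_br_leibniz a c e lie) ac eh add0r.
  by apply: kill => //; exact: lc_br_l.
have bG : br b G = 0.
  by rewrite -ce (lie_br_leibniz b c e lie) bc lie.1 add0r kill.
(* from here on, ad a and ad b are commuting operators on W = <h, A, G> *)
have step x : br a (br b x) = br c x + br b (br a x).
  by rewrite (lie_br_leibniz a b x lie) ab.
have bh : br b h = br a e.
  by rewrite -bc step lie.1 add0r ac.
have bA : br b A = be' *: A + al *: br a A.
  rewrite -ah; have := step h; rewrite ch add0r bh => <-.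
  by rewrite ae !lie_brE ah aG scaler0 addr0.
have indep k0 k1 k2 : k0 *: h + k1 *: A + k2 *: G = 0 ->
    [/\ k0 = 0, k1 = 0 & k2 = 0].
  move=> k_eq0; have [] := @mx7_inj _ a b c h e A G 0 0 0 k0 0 k1 k2 M_unit.
    by rewrite -k_eq0 !scale0r !add0r addrA.
  by case=> _ _ _ -> [_ -> ->].
(* [ad a, ad b] = ad c, which kills A *)
have x0ga : x0 * ga = be' * x2.
  have := step A; rewrite cA add0r bA aA !lie_brE ah aG bh bA bG ae aA => eqA.
  have [|_ _ /eqP] := indep 0 0 (x0 * ga - be' * x2).
    apply/rowP => i; move/rowP/(_ i): eqA; rewrite !mxE => eqA.
    lra.
  by rewrite subr_eq0 => /eqP.
have beG : br b (br a e) = be' *: br a e + al *: br b A.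
  by rewrite {1}ae !lie_brE bh bG scaler0 addr0.
(* [a, [b, e]] - [b, [a, e]] = [c, e] = G, in coordinates *)
have [q1x0 q1x1 q1x2] : [/\ (q0 - al ^+ 2) * x0 = be' ^+ 2,
    (q0 - al ^+ 2) * x1 = - (p - 2 * al * be') &
    (q0 - al ^+ 2) * x2 = 1 + be' * ga].
  have := step e; rewrite ce beG be ep0 bA !lie_brE ah aG aA ae => eqG.
  have [|/eqP E0 /eqP E1 /eqP E2] := indep ((q0 - al ^+ 2) * x0 - be' ^+ 2)
    ((q0 - al ^+ 2) * x1 + (p - 2 * al * be'))
    ((q0 - al ^+ 2) * x2 - (1 + be' * ga)).
    apply/rowP => i; move/rowP/(_ i): eqG; rewrite !mxE => eqG.
    lra.
  by split; apply/eqP; rewrite -subr_eq0 ?opprK.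
have be'0 : be' = 0.
  have : be' ^+ 2 * ga = be' * (1 + be' * ga).
    by rewrite -q1x0 -q1x2 -mulrA x0ga mulrCA.
  by lra.
move: q1x0 q1x1 q1x2; rewrite be'0 expr0n mulr0 subr0 mul0r addr0.
set q := q0 - al ^+ 2 => qx0 qx1 qx2.
have q0_neq0 : q != 0.
  by apply: contra_eq_neq qx2 => ->; rewrite mul0r eq_sym oner_neq0.
have x2E : x2 = q^-1 by rewrite -[LHS]mul1r -(mulVf q0_neq0) -mulrA qx2 mulr1.
have x0_0 : x0 = 0.
  by move/eqP: qx0; rewrite mulf_eq0 (negbTE q0_neq0) => /eqP.
have x1E : x1 = - (p / q) by rewrite -mulNr -qx1 mulrC mulKf.
exists (p / q), ga, q, (s0 - 2 * al * ga); split=> //.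
- by rewrite mulf_neq0 ?invr_neq0.
- by rewrite -invr_gt0 -x2E.
move: aA ae bA; rewrite x0_0 x1E x2E be'0 => aA ae bA.
have [b' b'_def] : exists b', b' = b - al *: a by exists (b - al *: a).
have [e' e'_def] : exists e', e' = e - al *: h by exists (e - al *: h).
have M'_unit : mx7 a b' c h e' A G \in unitmx.
  have -> : mx7 a b' c h e' A G =
      mx7 (row7 1 0 0 0 0 0 0) (row7 (- al) 1 0 0 0 0 0) (row7 0 0 1 0 0 0 0)
        (row7 0 0 0 1 0 0 0) (row7 0 0 0 (- al) 1 0 0) (row7 0 0 0 0 0 1 0)
        (row7 0 0 0 0 0 0 1) *m M.
    rewrite mx7_mul !mulmx_row7 b'_def e'_def; congr mx7;
      by apply/rowP => i; rewrite !mxE; ring.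
  rewrite unitmx_mul M_unit andbT; apply: mx7_unit_lower.
    by apply: ord7P; apply: ord7P => //; rewrite !mxE.
  by apply: ord7P; rewrite !mxE /= oner_neq0.
have ab' : br a b' = c by rewrite b'_def !lie_brE ab lie.1 scaler0 subr0.
have b'c : br b' c = e' by rewrite b'_def e'_def !lie_brE bc ac.
have ae' : br a e' = ga *: G.
  rewrite e'_def !lie_brE ae ah; by apply/rowP => i; rewrite !mxE; ring.
have b'h : br b' h = ga *: G.
  rewrite b'_def !lie_brE bh ae ah; by apply/rowP => i; rewrite !mxE; ring.
have ce' : br c e' = G by rewrite e'_def !lie_brE ce ch scaler0 subr0.
have b'A : br b' A = 0.
  by rewrite b'_def !lie_brE bA scale0r add0r subrr.
have b'G : br b' G = 0 by rewrite b'_def !lie_brE bG aG scaler0 subr0.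
have b'e' : br b' e' = p *: h + q *: A + (s0 - 2 * al * ga) *: G.
  rewrite b'_def e'_def !lie_brE be bh ae ah ep0 /q.
  by apply/rowP => i; rewrite !mxE; ring.
have he' : br h e' = 0 by rewrite e'_def !lie_brE eh lie.1 scaler0 subr0.
have killW u w : u \in L 3 -> w \in L 3 -> br u w = 0.
  by move=> uL wL; apply: kill => //; apply: sub21; exact: sub32.
have hA : br h A = 0 by exact: killW.
have hG : br h G = 0 by exact: killW.
have AG : br A G = 0 by exact: killW.
have e'A : br e' A = 0.
  by rewrite e'_def !lie_brE hA scaler0 subr0 kill // sub21.
have e'G : br e' G = 0.
  by rewrite e'_def !lie_brE hG scaler0 subr0 kill // sub21.
apply: (@lie_isomorphic_table _ _ _ a b' c h e' A G) => //; first exact: lie.1.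
move=> i j; rewrite -(lie_br_delta (table5 _ _ _ _)).
move: i j; do 2!apply: ord7P => //; move=> _; rewrite !delta_row7.
all: rewrite !row_mx7 /= table5_br mulmx_row7.
all: rewrite ?ab' ?ac ?ah ?ae' ?aA ?aG ?b'c ?b'h ?b'e' ?b'A ?b'G.
all: rewrite ?ch ?ce' ?cA ?cG ?he' ?hA ?hG ?e'A ?e'G ?AG.
all: apply/rowP => i; rewrite !mxE; (ring || by field).
Qed.
End StructureFive.

(** * Nilpotent algebras near the family g1 *)

Section StructureOne.
Context {R : realType} (mu : tensor7 R) (nil : nilpotent_var mu).
Local Notation br := (lie_br mu).
Local Notation L := (lower_central mu).

Lemma nilpotent_dim_lt n v :
  v \in L n -> v != 0 -> (\dim (L n.+1) < \dim (L n))%N.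
Proof.
move=> vL v0; have := nilpotent_lc_neq nil vL v0.
by rewrite ltn_neqAle dimvS ?lc_sub // andbT dimv_leqif_eq ?lc_sub.
Qed.

(** Suppose that h, in the span of d and e, lies in L3, and let b' be the vector
    of <a, b> with [b', c] = h.  If k0 = [b', h] were not killed by a, the
    series L3, L4, L5 would be <h, k0, l>, <k0, l>, <l> with l = [a, k0].  The
    Jacobi identities for (a', b', d'), (b', c, d') and (a', c, d') then
    make both a' and b' kill k0. *)
Lemma nilpotent_not_filiform (a b c d e f g : 'rV[R]_7) p q
    (h := p *: d + q *: e) :
  br a b = c -> br a c = d -> br b c = e -> br b e = f ->
  L 2 = <<[:: d; e; f; g]>>%VS -> f \in L 3 -> g \in L 3 ->
  (forall v, exists x y w, w \in L 1 /\ v = x *: a + y *: b + w) ->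
  h \in L 3 ->
  br a (p ^+ 2 *: br a d + (2 * p * q) *: br a e + q ^+ 2 *: f) = 0.
Proof.
move=> ab ac bc be L2E fL gL fullE hL.
have lie : lie_structure mu by case: nil.
set k0 := (_ + _ + _ : 'rV[R]_7); apply/eqP; apply: contraT => l_neq0.
have pq_neq0 : p ^+ 2 + q ^+ 2 != 0.
  apply: contraNneq l_neq0 => /eqP; rewrite paddr_eq0 ?sqr_ge0 // !sqrf_eq0.
  case/andP=> /eqP p0 /eqP q0.
  by rewrite /k0 p0 q0 !expr0n !mulr0 !scale0r !addr0 lie_br0r.
set n := p ^+ 2 + q ^+ 2 in pq_neq0.
have sub32 := subvP (lc_sub mu 2); have sub21 := subvP (lc_sub mu 1).
have sub43 := subvP (lc_sub mu 3); have sub54 := subvP (lc_sub mu 4).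
have cL : c \in L 1 by rewrite -ab; apply/lc_br/lc_full.
have bd : br b d = br a e.
  by rewrite -ac (lie_br_leibniz b a c lie) bc (lie_br_skew a b lie) ab
    -scaleN1r lie_brZl lie.1 scaler0 add0r.
(* a rotation of (a, b), up to scale: [a', b'] = c and [b', c] = h *)
pose b' := p *: a + q *: b; pose a' := (q / n) *: a - (p / n) *: b.
pose d' := (q / n) *: d - (p / n) *: e.
have aE : a = q *: a' + (p / n) *: b'.
  by rewrite /a' /b'; apply/rowP => i; rewrite !mxE /n; field.
have bE : b = (q / n) *: b' - p *: a'.
  by rewrite /a' /b'; apply/rowP => i; rewrite !mxE /n; field.
have dE : d = q *: d' + (p / n) *: h.
  by rewrite /d' /h; apply/rowP => i; rewrite !mxE /n; field.
have eE : e = (q / n) *: h - p *: d'.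
  by rewrite /d' /h; apply/rowP => i; rewrite !mxE /n; field.
have a'b' : br a' b' = c.
  rewrite /a' /b' !lie_brE !lie.1 (lie_br_skew a b lie) ab.
  by apply/rowP => i; rewrite !mxE /n; field.
have b'c : br b' c = h by rewrite /b' !lie_brE ac bc.
have a'c : br a' c = d' by rewrite /a' /d' !lie_brE ac bc.
have b'h : br b' h = k0.
  rewrite /b' /h /k0 !lie_brE bd be.
  by apply/rowP => i; rewrite !mxE; ring.
clearbody a' b' d'; clearbody k0 h.
have step x : br a' (br b' x) = br c x + br b' (br a' x).
  by rewrite (lie_br_leibniz a' b' x lie) a'b'.
set l := br a k0 in l_neq0.
have k0L : k0 \in L 4 by rewrite -b'h lc_br_l.
have lL : l \in L 5 by exact: lc_br_l.
have lt m : (m <= 5)%N -> (\dim (L m.+1) < \dim (L m))%N.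
  move=> m5; apply: nilpotent_dim_lt l_neq0.
  (* l lies in every L m with m <= 5 *)
  have [j ->] : exists j, m = (5 - j)%N by exists (5 - m)%N; rewrite subKn.
  by elim: j => [//|j IHj]; move: IHj; case: (5 - j)%N (subnS 5 j) => [|k] -> //;
     exact/subvP/lc_sub.
have dim2 : (\dim (L 2) <= 4)%N by rewrite L2E; exact: dim_span.
have dim3 : (\dim (L 3) <= 3)%N by rewrite -ltnS (leq_trans (lt 2 isT)).
have dim4 : (\dim (L 4) <= 2)%N by rewrite -ltnS (leq_trans (lt 3 isT)).
have dim5 : (\dim (L 5) <= 1)%N by rewrite -ltnS (leq_trans (lt 4 isT)).
have L6E x : x \in L 6 -> x = 0.
  have : (\dim (L 6) <= 0)%N by rewrite -ltnS (leq_trans (lt 5 isT)).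
  by rewrite leqn0 dimv_eq0 => /eqP ->; rewrite memv0 => /eqP.
have fr1 : free [:: l] by rewrite seq1_free.
have L5E : <<[:: l]>>%VS = L 5.
  by apply/eqP; rewrite eqEdim (free_dim fr1) dim5 span_sub //= lL.
have k0L5 : k0 \notin L 5.
  by apply: contraNN l_neq0 => k0L5; apply/eqP/L6E/lc_br_l.
have fr2 : free [:: k0; l] by rewrite free_cons L5E k0L5.
have L4E : <<[:: k0; l]>>%VS = L 4.
  by apply/eqP; rewrite eqEdim (free_dim fr2) dim4 span_sub //= k0L sub54.
have hL4 : h \notin L 4.
  by apply: contraNN k0L5 => hL4; rewrite -b'h lc_br_l.
have fr3 : free [:: h; k0; l] by rewrite free_cons L4E hL4.
have L3E : <<[:: h; k0; l]>>%VS = L 3.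
  apply/eqP; rewrite eqEdim (free_dim fr3) dim3 span_sub //= hL.
  by rewrite sub43 // sub43 // sub54.
have d'L : d' \in L 2 by rewrite -a'c lc_br_l.
have a'h : br a' h \in L 4 by exact: lc_br_l.
have b'd' : br b' d' = br a' h.
  by rewrite -a'c -b'c step lie.1 add0r.
have [th [ph [ps a'd']]] : exists i j k, br a' d' = i *: h + j *: k0 + k *: l.
  by apply: mem_span3; rewrite L3E; exact: lc_br_l.
have th0 : th != 0.
  have := lt 3 isT; rewrite ltnNge; apply: contraNneq => th0; apply: dimvS.
  apply/br_vspaceP => u v uL _.
  have [x [y [w [wL ->]]]] : exists x y w, w \in L 3 /\ u = x *: d' + y *: h + w.
    have [i1 [i2 [i3 [i4 ->]]]] : exists i j k m, u = i *: d + j *: e + k *: f + m *: g.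
      by apply: mem_span4; rewrite -L2E.
    exists (i1 * q - i2 * p), (i1 * (p / n) + i2 * (q / n)), (i3 *: f + i4 *: g).
    rewrite rpredD ?rpredZ //; split=> //.
    by rewrite {1}dE {1}eE; apply/rowP => i; rewrite !mxE; ring.
  have [x' [y' [w' [w'L ->]]]] : exists x y w, w \in L 1 /\ v = x *: a' + y *: b' + w.
    have [i1 [i2 [w' [w'L ->]]]] := fullE v.
    exists (i1 * q - i2 * p), (i1 * (p / n) + i2 * (q / n)), w'; split=> //.
    by rewrite {1}aE {1}bE; apply/rowP => i; rewrite !mxE; ring.
  rewrite !lie_brDl rpredD //; last exact: lc_br.
  rewrite !lie_brZl rpredD // rpredZ //; last exact: lc_br.
  rewrite (lie_br_skew _ d' lie) memvN !lie_brDl rpredD //; last first.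
    exact: (lc_derived lie w'L d'L).
  rewrite !lie_brZl a'd' b'd' th0 scale0r add0r.
  by rewrite !(rpredD, rpredZ) // sub54.
have a'L5 x : x \in L 4 -> br a' x \in L 5 by exact: lc_br_l.
have l_kill x : br x l = 0 by apply/L6E/lc_br_l.
have cL4 x : x \in L 4 -> br c x = 0 by move=> xL; apply/L6E/(lc_derived lie).
have chL : br c h \in L 5 by exact: lc_derived.
have d'h : br d' h = 0.
  have := lie_br_leibniz a' c h lie; rewrite a'c (cL4 _ a'h) addr0 => <-.
  by apply/L6E/lc_br_l.
have [la cd'] : exists la, br c d' = - th *: k0 + la *: l.
  have : br a' (br b' d') - br b' (ph *: k0 + ps *: l) \in L 5.
    rewrite b'd' rpredB //; first exact: lc_br_l.
    by apply: (lc_br_l _ lie); rewrite rpredD ?rpredZ // sub54.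
  rewrite -L5E => /mem_span1[la laE]; exists la.
  rewrite -laE step a'd' !lie_brE b'h.
  by apply/rowP => i; rewrite !mxE; ring.
have b'k0 : br b' k0 = 0.
  have := lie_br_leibniz b' c d' lie; rewrite b'c b'd' (cL4 _ a'h) addr0.
  rewrite (lie_br_skew d' h lie) d'h oppr0 cd' !lie_brE l_kill scaler0 addr0.
  by move/eqP; rewrite scaler_eq0 oppr_eq0 (negbTE th0) => /eqP.
have ch : br c h = - br a' k0.
  have := lie_br_leibniz a' c d' lie; rewrite a'c lie.1 add0r a'd' cd' !lie_brE.
  rewrite !l_kill (cL4 _ k0L) !scaler0 !addr0 => /eqP.
  by rewrite scaleNr -scalerN eq_sym -subr_eq0 -scalerBr scaler_eq0 (negbTE th0)
    subr_eq0 => /eqP.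
have a'k0 : br a' k0 = 0.
  have := step h; rewrite b'h ch.
  have : br a' h \in <<[:: k0; l]>>%VS by rewrite L4E.
  case/mem_span2 => i [j ->]; rewrite !lie_brE b'k0 l_kill !scaler0 !addr0.
  move/rowP=> E; apply/rowP => k; have := E k; rewrite !mxE; lra.
by move: l_neq0; rewrite /l aE !lie_brE a'k0 b'k0 !scaler0 addr0 eqxx.
Qed.

(** The three inequalities make the quadratic form
    p ^ 2 [a, [a, d]] + 2 p q [a, [a, e]] + q ^ 2 [a, f] positive definite in the
    g-coordinate, so that no nonzero combination of d and e lies in L3. *)
Lemma structure5_nilpotent (a b c d e f g : 'rV[R]_7) :
  mx7 a b c d e f g \in unitmx ->
  br a b = c -> br a c = d -> br b c = e -> br b e = f -> br c e = g ->
  0 < br a (br a d) 0 ixg -> 0 < br a f 0 ixg ->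
  (br a (br a e) 0 ixg) ^+ 2 < br a (br a d) 0 ixg * br a f 0 ixg ->
  exists a1 a2 b1 b2 s, [/\ br a d = a1 *: f + a2 *: g,
    br a e = b1 *: f + b2 *: g, br b f = s *: g &
    lie_isomorphic mu (table1 a1 a2 b1 b2 s)].
Proof.
move=> M_unit ab ac bc be ce pos1 pos2 disc.
have lie : lie_structure mu by case: nil.
have cL : c \in L 1 by rewrite -ab; apply/lc_br/lc_full.
have dL : d \in L 2 by rewrite -ac; exact: lc_br_l.
have eL : e \in L 2 by rewrite -bc; exact: lc_br_l.
have fL : f \in L 3 by rewrite -be; exact: lc_br_l.
have gL : g \in L 4 by rewrite -ce; exact: (lc_derived lie cL eL).
have sub43 := subvP (lc_sub mu 3).
have sub32 := subvP (lc_sub mu 2); have sub21 := subvP (lc_sub mu 1).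
have := mx7_free M_unit; rewrite free_cons => /andP[_].
rewrite free_cons => /andP[_ fr5].
have nz x : x \in [:: c; d; e; f; g] -> x != 0 by exact: free_not0.
have neL n x : x \in [:: c; d; e; f; g] -> x \in L n -> L n.+1 != L n.
  by move=> /nz x0 xL; exact: nilpotent_lc_neq nil xL x0.
have [_ L1E L2E] : [/\ free [:: c; d; e; f; g], L 1 = <<[:: c; d; e; f; g]>>%VS &
    L 2 = <<[:: d; e; f; g]>>%VS].
  apply: (lc_flag lie M_unit _ cL); last by rewrite /= dL eL !sub32 // sub43.
  by apply: (neL _ _ _ cL); rewrite inE eqxx.
have fr4 := free_behead fr5.
have fr2 := free_behead (free_behead fr4); have fr1 := free_behead fr2.
have fullE v : exists x y w, w \in L 1 /\ v = x *: a + y *: b + w.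
  pose u := v *m invmx (mx7 a b c d e f g).
  exists (u 0 ixa), (u 0 ixb), (u 0 ixc *: c + (u 0 ixd *: d + (u 0 ixe *: e +
    (u 0 ixf *: f + u 0 ixg *: g)))); split.
    by rewrite !(rpredD, rpredZ) // sub21 // ?sub32 // sub43.
  by rewrite -addrA -mulmx_row7 -row7E /u mulmxKV.
have L3E : L 3 = <<[:: f; g]>>%VS.
  apply: subv_anti; apply/andP; split; last by apply: span_sub; rewrite /= fL sub43.
  apply/subvP => w wL.
  have [p [q [k [l wE]]]] : exists i j k l, w = i *: d + j *: e + k *: f + l *: g.
    by apply: mem_span4; rewrite -L2E sub32.
  have hL : p *: d + q *: e \in L 3.
    have -> : p *: d + q *: e = w - (k *: f + l *: g).
      by rewrite wE; apply/rowP => i; rewrite !mxE; ring.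
    by rewrite rpredB // rpredD // rpredZ // sub43.
  have := nilpotent_not_filiform ab ac bc be L2E fL (sub43 _ gL) fullE hL.
  rewrite !lie_brE => /rowP/(_ ixg); rewrite !mxE.
  set x := br a (br a d) 0 ixg in pos1 disc *.
  set y := br a (br a e) 0 ixg in disc *.
  set z := br a f 0 ixg in pos2 disc * => pq.
  (* the hypothesis pq is the vanishing at (p, q) of a positive definite form *)
  have sq : x * (p ^+ 2 * x + 2 * p * q * y + q ^+ 2 * z) =
      (p * x + q * y) ^+ 2 + q ^+ 2 * (x * z - y ^+ 2) by ring.
  have q0 : q = 0.
    move/eqP: sq; rewrite pq mulr0 eq_sym paddr_eq0 ?sqr_ge0 //; last first.
      by rewrite mulr_ge0 ?sqr_ge0 // subr_ge0 ltW.
    case/andP=> _; rewrite mulf_eq0 sqrf_eq0 subr_eq0 (gt_eqF disc) orbF.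
    by move/eqP.
  have p0 : p = 0.
    move/eqP: pq; rewrite q0 expr0n mulr0 !mul0r !addr0 mulf_eq0 sqrf_eq0.
    by rewrite (gt_eqF pos1) orbF => /eqP.
  rewrite wE p0 q0 !scale0r !add0r rpredD // rpredZ // memv_span //.
    by rewrite inE eqxx.
  by rewrite !inE eqxx orbT.
have L4E : L 4 = <<[:: g]>>%VS.
  apply: (span_maximal fr1 _ (lc_sub mu 3)); last by rewrite L3E (free_dim fr2).
    by apply: span_sub; rewrite /= gL.
  by apply: (neL _ _ _ fL); rewrite !inE eqxx !orbT.
have L5E x : x \in L 5 -> x = 0.
  suff -> : L 5 = 0%VS by rewrite memv0 => /eqP.
  rewrite -span_nil; apply: (span_maximal (nil_free _) _ (lc_sub mu 4)).
  - by rewrite span_nil sub0v.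
  - by apply: (neL _ _ _ gL); rewrite !inE eqxx !orbT.
  - by rewrite L4E (free_dim fr1).
have kill x y : x \in L 1 -> y \in L 3 -> br x y = 0.
  by move=> xL yL; apply/L5E/(lc_derived lie).
have g_central x : br x g = 0 by apply/L5E/lc_br_l.
have [a1 [a2 ad]] : exists i j, br a d = i *: f + j *: g.
  by apply: mem_span2; rewrite -L3E lc_br_l.
have [b1 [b2 ae]] : exists i j, br a e = i *: f + j *: g.
  by apply: mem_span2; rewrite -L3E lc_br_l.
have [rho af] : exists i, br a f = i *: g.
  by apply: mem_span1; rewrite -L4E lc_br_l.
have [s bf] : exists i, br b f = i *: g.
  by apply: mem_span1; rewrite -L4E lc_br_l.
have step x : br a (br b x) = br c x + br b (br a x).
  by rewrite (lie_br_leibniz a b x lie) ab.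
have bd : br b d = b1 *: f + b2 *: g.
  by have := step c; rewrite lie.1 add0r bc ac ae => <-.
have rhoE : rho = 1 + b1 * s.
  have := step e; rewrite be ce ae !lie_brE bf g_central af scaler0 addr0 scalerA.
  rewrite -{2}[g]scale1r -scalerDl => /eqP; rewrite -subr_eq0 -scalerBl scaler_eq0.
  by rewrite (negbTE (nz g _)) ?orbF ?subr_eq0 ?inE ?eqxx ?orbT // => /eqP.
have cd : br c d = (b1 * (1 + b1 * s) - a1 * s) *: g.
  have := step d; rewrite bd ad !lie_brE af bf !g_central !scaler0 !addr0 => E.
  rewrite scalerBl -scalerA -rhoE -[(a1 * s) *: g]scalerA E addrK //.
have cf : br c f = 0 by exact: kill.
have de : br d e = 0.
  have cae : br c (br a e) = 0 by apply: kill => //; exact: lc_br_l.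
  by have := lie_br_leibniz a c e lie; rewrite ac ce g_central cae addr0.
have df : br d f = 0 by apply: kill => //; exact: sub21.
have ef : br e f = 0 by apply: kill => //; exact: sub21.
rewrite rhoE in af.
exists a1, a2, b1, b2, s; split=> //.
apply: (@lie_isomorphic_table _ _ _ a b c d e f g) => //; first exact: lie.1.
move=> i j; rewrite -(lie_br_delta (table1 _ _ _ _ _)).
move: i j; do 2!apply: ord7P => //; move=> _; rewrite !delta_row7.
all: rewrite !row_mx7 /= table1_br mulmx_row7.
all: rewrite ?ab ?ac ?ad ?ae ?af ?bc ?bd ?be ?bf ?cd ?ce ?cf ?de ?df ?ef ?g_central.
all: by apply/rowP => i; rewrite !mxE; ring.
Qed.

End StructureOne.

(** * Entrywise continuity *)

Section EntrywiseContinuity.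
Context {R : realType} {T : topologicalType} (x0 : T).

(** Continuity at a point, entry by entry: the vectors built from iterated
    brackets are polynomial in the entries of the structure tensor. *)
Definition cont_at (h : T -> R) := h x @[x --> x0] --> h x0.

Definition mx_cont_at m n (F : T -> 'M[R]_(m, n)) :=
  forall i j, cont_at (fun x => F x i j).

Lemma cont_at_cst k : cont_at (fun=> k).
Proof. exact: cvg_cst. Qed.

Lemma cont_atD h k : cont_at h -> cont_at k -> cont_at (fun x => h x + k x).
Proof. by move=> hc kc; exact: cvgD. Qed.

Lemma cont_atN h : cont_at h -> cont_at (fun x => - h x).
Proof. by move=> hc; exact: cvgN. Qed.

Lemma cont_atM h k : cont_at h -> cont_at k -> cont_at (fun x => h x * k x).
Proof. by move=> hc kc; exact: cvgM. Qed.

Lemma cont_atV h : h x0 != 0 -> cont_at h -> cont_at (fun x => (h x)^-1).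
Proof. by move=> h0 hc; exact: cvgV. Qed.

Lemma cont_at_sum (I : Type) (r : seq I) (P : pred I) (h : I -> T -> R) :
  (forall i, P i -> cont_at (h i)) -> cont_at (fun x => \sum_(i <- r | P i) h i x).
Proof. by move=> hc; apply: cvg_big => //; exact: add_continuous. Qed.

Lemma cont_at_prod (I : Type) (r : seq I) (P : pred I) (h : I -> T -> R) :
  (forall i, P i -> cont_at (h i)) -> cont_at (fun x => \prod_(i <- r | P i) h i x).
Proof. by move=> hc; apply: cvg_big => //; exact: mul_continuous. Qed.

Lemma eq_cont_at h k : h =1 k -> cont_at h -> cont_at k.
Proof. by move=> /funext ->. Qed.

Lemma cont_at_gt0 h : cont_at h -> 0 < h x0 -> \forall x \near x0, 0 < h x.
Proof. by move=> hc h0; exact: cvgr_gt hc _ h0. Qed.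

Lemma cont_at_neq0 h : cont_at h -> h x0 != 0 -> \forall x \near x0, h x != 0.
Proof. by move=> hc h0; exact: cvgr_neq0 hc h0. Qed.

Lemma mx_cont_cst m n (A : 'M[R]_(m, n)) : mx_cont_at (fun=> A).
Proof. by move=> i j; exact: cont_at_cst. Qed.

Lemma mx_contD m n (F G : T -> 'M[R]_(m, n)) :
  mx_cont_at F -> mx_cont_at G -> mx_cont_at (fun x => F x + G x).
Proof.
move=> Fc Gc i j; apply: (eq_cont_at (h := fun x => F x i j + G x i j)).
  by move=> x; rewrite mxE.
exact: cont_atD.
Qed.

Lemma mx_contZ m n h (F : T -> 'M[R]_(m, n)) :
  cont_at h -> mx_cont_at F -> mx_cont_at (fun x => h x *: F x).
Proof.
move=> hc Fc i j; apply: (eq_cont_at (h := fun x => h x * F x i j)).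
  by move=> x; rewrite mxE.
exact: cont_atM.
Qed.

Lemma mx_contN m n (F : T -> 'M[R]_(m, n)) :
  mx_cont_at F -> mx_cont_at (fun x => - F x).
Proof.
move=> Fc i j; apply: (eq_cont_at (h := fun x => - F x i j)).
  by move=> x; rewrite mxE.
exact: cont_atN.
Qed.

Lemma mx_contM m n p (F : T -> 'M[R]_(m, n)) (G : T -> 'M[R]_(n, p)) :
  mx_cont_at F -> mx_cont_at G -> mx_cont_at (fun x => F x *m G x).
Proof.
move=> Fc Gc i j.
apply: (eq_cont_at (h := fun x => \sum_k F x i k * G x k j)).
  by move=> x; rewrite mxE.
by apply: cont_at_sum => k _; exact: cont_atM.
Qed.

Lemma cont_at_det n (F : T -> 'M[R]_n) : mx_cont_at F -> cont_at (fun x => \det (F x)).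
Proof.
move=> Fc; rewrite /determinant; apply: cont_at_sum => s _.
by apply: cont_atM; [exact: cont_at_cst | exact: cont_at_prod].
Qed.

Lemma mx_cont_adj n (F : T -> 'M[R]_n) : mx_cont_at F -> mx_cont_at (fun x => \adj (F x)).
Proof.
move=> Fc i j; apply: (eq_cont_at (h := fun x => cofactor (F x) j i)).
  by move=> x; rewrite mxE.
apply: cont_atM; first exact: cont_at_cst.
apply: cont_at_det => k l.
apply: (eq_cont_at (h := fun x => F x (lift j k) (lift i l))) => [x|//].
by rewrite !mxE.
Qed.

Lemma near_unitmx n (F : T -> 'M[R]_n) : mx_cont_at F -> F x0 \in unitmx ->
  \forall x \near x0, F x \in unitmx.
Proof.
move=> Fc; rewrite unitmxE unitfE => F0.
have := cont_at_neq0 (cont_at_det Fc) F0; apply: filterS => x.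
by rewrite unitmxE unitfE.
Qed.

Lemma mx_cont_inv n (F : T -> 'M[R]_n) : mx_cont_at F -> F x0 \in unitmx ->
  mx_cont_at (fun x => invmx (F x)).
Proof.
move=> Fc F0.
have : mx_cont_at (fun x => (\det (F x))^-1 *: \adj (F x)).
  apply: mx_contZ; last exact: mx_cont_adj.
  by apply: cont_atV; [rewrite -unitfE -unitmxE | exact: cont_at_det].
move=> adjc i j; rewrite /cont_at /invmx F0; apply: cvg_trans (adjc i j).
apply: near_eq_cvg; have := near_unitmx Fc F0; apply: filterS => x Fx.
by rewrite Fx.
Qed.

Lemma mx_cont_mx7 v0 v1 v2 v3 v4 v5 v6 :
  @mx_cont_at 1 7 v0 -> @mx_cont_at 1 7 v1 -> @mx_cont_at 1 7 v2 ->
  @mx_cont_at 1 7 v3 -> @mx_cont_at 1 7 v4 -> @mx_cont_at 1 7 v5 ->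
  @mx_cont_at 1 7 v6 ->
  mx_cont_at (fun x => mx7 (v0 x) (v1 x) (v2 x) (v3 x) (v4 x) (v5 x) (v6 x)).
Proof.
move=> c0 c1 c2 c3 c4 c5 c6; apply: ord7P => j.
- by apply: eq_cont_at (c0 0 j) => x; rewrite mxE.
- by apply: eq_cont_at (c1 0 j) => x; rewrite mxE.
- by apply: eq_cont_at (c2 0 j) => x; rewrite mxE.
- by apply: eq_cont_at (c3 0 j) => x; rewrite mxE.
- by apply: eq_cont_at (c4 0 j) => x; rewrite mxE.
- by apply: eq_cont_at (c5 0 j) => x; rewrite mxE.
- by apply: eq_cont_at (c6 0 j) => x; rewrite mxE.
Qed.

End EntrywiseContinuity.

Section BracketContinuity.
Context {R : realType}.

Lemma entry_continuous (T : topologicalType) m n i j :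
  continuous (fun M : 'M[T]_(m, n) => M i j).
Proof.
move=> M A MA; exists (fun k l => if (k, l) == (i, j) then A else setT).
  by move=> k l; case: eqP => [[-> ->]//|_]; exact: filterT.
by move=> N /(_ i j); rewrite /= eqxx.
Qed.

Lemma tensor_cont (mu : tensor7 R) i j k :
  cont_at mu (fun nu : tensor7 R => nu i j 0 k).
Proof.
apply: (@cvg_comp _ _ _ (fun nu : tensor7 R => nu i j) (fun v : 'rV[R]_7 => v 0 k)
  _ (nbhs (mu i j))); first exact: entry_continuous.
exact: coord_continuous.
Qed.

Lemma mx_cont_br (mu : tensor7 R) (u v : tensor7 R -> 'rV[R]_7) :
  mx_cont_at mu u -> mx_cont_at mu v ->
  mx_cont_at mu (fun nu => lie_br nu (u nu) (v nu)).
Proof.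
move=> uc vc i j; apply: (eq_cont_at (h := fun nu : tensor7 R =>
    \sum_k \sum_l u nu 0 k * v nu 0 l * nu k l 0 j)).
  move=> nu; rewrite ord1 /lie_br summxE; apply: eq_bigr => k _.
  by rewrite summxE; apply: eq_bigr => l _; rewrite mxE.
apply: cont_at_sum => k _; apply: cont_at_sum => l _.
by apply: cont_atM; [exact: cont_atM | exact: tensor_cont].
Qed.

Lemma continuous_entries (T U : topologicalType) m n (F : T -> 'M[U]_(m, n)) :
  (forall i j, continuous (fun t => F t i j)) -> continuous F.
Proof.
move=> Fc t A [P FP PA].
have FP' ij : \forall s \near t, P ij.1 ij.2 (F s ij.1 ij.2) by exact: Fc.
have : \forall s \near t, forall ij, P ij.1 ij.2 (F s ij.1 ij.2).
  exact: filter_forall.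
apply: filterS => s Ps; apply: PA => i j.
exact: (Ps (i, j)).
Qed.

Lemma tensor_continuous (F : R -> tensor7 R) :
  (forall i j k, continuous (fun t => F t i j 0 k)) -> continuous F.
Proof.
move=> Fc; apply: continuous_entries => i j; apply: continuous_entries => k l.
by rewrite ord1; exact: Fc.
Qed.

End BracketContinuity.

(** * The families belong to the varieties and are continuous *)

Section Membership.
Context {R : realType}.
Implicit Types (mu : tensor7 R) (x y z : 'rV[R]_7).

Lemma g6_br r t k0 k1 k2 k3 k4 k5 k6 l0 l1 l2 l3 l4 l5 l6 :
  lie_br (g6 r t) (row7 k0 k1 k2 k3 k4 k5 k6) (row7 l0 l1 l2 l3 l4 l5 l6) =
  row7 0 0 (k0 * l1 - k1 * l0) (k0 * l2 - k2 * l0)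
    ((k0 * l3 - k3 * l0) + (k1 * l2 - k2 * l1))
    ((k0 * l4 - k4 * l0) + (k1 * l3 - k3 * l1)
     + r * t * ((k1 * l4 - k4 * l1) - (k2 * l3 - k3 * l2)))
    ((k0 * l5 - k5 * l0) + r * (k0 * l6 - k6 * l0) + (1 - t) * (k1 * l4 - k4 * l1)
     + r * (k1 * l5 - k5 * l1) + r ^+ 2 * (k1 * l6 - k6 * l1)
     + t * (k2 * l3 - k3 * l2)) :> 'rV[R]_7.
Proof. by rewrite -table6_g6 table6_br; congr row7; ring. Qed.

Lemma g6_lie r t : lie_structure (g6 r t : tensor7 R).
Proof.
split=> [x|x y z]; first exact: lie_br_table_alt.
rewrite (row7E x) (row7E y) (row7E z) !g6_br !row7D.
by apply/rowP; apply: ord7P; rewrite !mxE /=; ring.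
Qed.

Lemma g5_lie r t : lie_structure (g5 r t : tensor7 R).
Proof.
split=> [x|x y z]; first exact: lie_br_table_alt.
rewrite (row7E x) (row7E y) (row7E z) !g5_br !row7D.
by apply/rowP; apply: ord7P; rewrite !mxE /=; ring.
Qed.

(** If a bracket has its leading coordinate strictly later than its first
    argument, seven brackets vanish. *)
Lemma nilpotent_of_flag mu : lie_structure mu ->
  (forall x y (i : 'I_7), (forall j : 'I_7, (j < i)%N -> x 0 j = 0) ->
     lie_br mu x y 0 i = 0) -> nilpotent_var mu.
Proof.
move=> lie flag; split=> //; exists 7.
have Ln n : (n <= 7)%N -> forall x, x \in lower_central mu n ->
    forall i : 'I_7, (i < n)%N -> x 0 i = 0.
  elim: n => [//|n IHn] n7 x xL i i_n.
  have coordE y : y *m delta_mx i ixa = y 0 i *: delta_mx 0 ixa.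
    apply/rowP => k; rewrite !mxE (bigD1 i) //= mxE eqxx /=.
    rewrite big1 ?addr0 // => l li; by rewrite !mxE (negbTE li) mulr0.
  have : x *m delta_mx i ixa \in 0%VS.
    apply: (lc_kill (h := mulmxr (delta_mx i ixa))) xL => u v uL /=.
    rewrite coordE flag ?scale0r ?memv0 // => j ji.
    by apply: (IHn (ltnW n7) u uL); apply: leq_trans ji _; rewrite -ltnS.
  rewrite memv0 coordE => /eqP/rowP/(_ ixa).
  by rewrite !mxE /= mulr1.
apply/eqP; rewrite -subv0; apply/subvP => x xL; rewrite memv0; apply/eqP.
by apply/rowP => i; rewrite mxE (Ln 7 (leqnn _)).
Qed.

Lemma row7_zeros (x : 'rV[R]_7) (i : 'I_7) :
  (forall j : 'I_7, (j < i)%N -> x 0 j = 0) ->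
  let k (j : 'I_7) := if (j < i)%N then 0 else x 0 j in
  x = row7 (k ixa) (k ixb) (k ixc) (k ixd) (k ixe) (k ixf) (k ixg).
Proof.
move=> x_0 /=; apply/rowP => j; move: (x_0 j); move: j.
by apply: ord7P => xj0; rewrite mxE /=; case: ifP => // /xj0.
Qed.

Lemma gI_nilpotent alpha : nilpotent_var (gI alpha : tensor7 R).
Proof.
apply: nilpotent_of_flag => [|x y i /row7_zeros ->]; first exact: g6_lie.
rewrite /gI (row7E y) g6_br.
by move: i; apply: ord7P; rewrite mxE /=; ring.
Qed.

Lemma g1_nilpotent la : nilpotent_var (g1 la : tensor7 R).
Proof.
apply: nilpotent_of_flag => [|x y i /row7_zeros ->]; first exact: g5_lie.
rewrite /g1 (row7E y) g5_br.
by move: i; apply: ord7P; rewrite mxE /=; ring.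
Qed.

Lemma g6_sn r t : sn75_var (g6 r t : tensor7 R).
Proof.
split=> [|x1 x2 x3 x4 x5 x6]; first exact: g6_lie.
pose in2 x := exists k2 k3 k4 k5 k6, x = row7 0 0 k2 k3 k4 k5 k6 :> 'rV[R]_7.
have br1 x y : in2 (lie_br (g6 r t) x y).
  by rewrite (row7E x) (row7E y) g6_br; do 5!eexists.
have [a2 [a3 [a4 [a5 [a6 ->]]]]] := br1 x1 x2.
have [b2 [b3 [b4 [b5 [b6 ->]]]]] := br1 x3 x4.
rewrite (row7E x5) (row7E x6) !g6_br.
by apply/rowP; apply: ord7P; rewrite !mxE /=; ring.
Qed.

Lemma g5_sn r t : sn75_var (g5 r t : tensor7 R).
Proof.
split=> [|x1 x2 x3 x4 x5 x6]; first exact: g5_lie.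
pose in2 x := exists k2 k3 k4 k5 k6, x = row7 0 0 k2 k3 k4 k5 k6 :> 'rV[R]_7.
have br1 x y : in2 (lie_br (g5 r t) x y).
  by rewrite (row7E x) (row7E y) g5_br; do 5!eexists.
have [a2 [a3 [a4 [a5 [a6 ->]]]]] := br1 x1 x2.
have [b2 [b3 [b4 [b5 [b6 ->]]]]] := br1 x3 x4.
rewrite (row7E x5) (row7E x6) !g5_br.
by apply/rowP; apply: ord7P; rewrite !mxE /=; ring.
Qed.

Lemma g6_continuous r : continuous (g6 r : R -> tensor7 R).
Proof.
apply: tensor_continuous => i j k t.
suff [u [v ->]] : exists u v,
    (fun t => (g6 r t : tensor7 R) i j 0 k) = (fun t => u + t * v).
  apply: cvgD; first exact: cvg_cst.
  by apply: cvgM; [exact: cvg_id | exact: cvg_cst].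
exists (g6 r 0 i j 0 k), (g6 r 1 i j 0 k - g6 r 0 i j 0 k).
apply/funext => s; rewrite -!lie_br_delta (row7E (delta_mx 0 i)).
rewrite (row7E (delta_mx 0 j)) !g6_br.
by move: k; apply: ord7P; rewrite !mxE /=; ring.
Qed.

Lemma g5_continuous r : continuous (g5 r : R -> tensor7 R).
Proof.
apply: tensor_continuous => i j k t.
suff [u [v ->]] : exists u v,
    (fun t => (g5 r t : tensor7 R) i j 0 k) = (fun t => u + t * v).
  apply: cvgD; first exact: cvg_cst.
  by apply: cvgM; [exact: cvg_id | exact: cvg_cst].
exists (g5 r 0 i j 0 k), (g5 r 1 i j 0 k - g5 r 0 i j 0 k).
apply/funext => s; rewrite -!lie_br_delta (row7E (delta_mx 0 i)).
rewrite (row7E (delta_mx 0 j)) !g5_br.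
by move: k; apply: ord7P; rewrite !mxE /=; ring.
Qed.

End Membership.

(** * Neighbourhoods *)

Section NearbyStructures.
Context {R : realType}.
Implicit Types (mu nu : tensor7 R).
Let a : 'rV[R]_7 := delta_mx 0 ixa.
Let b : 'rV[R]_7 := delta_mx 0 ixb.

Ltac cont_br :=
  repeat first [exact: mx_cont_cst | apply: mx_cont_br | apply: mx_cont_mx7].

Lemma coord_mx7 (M : 'M[R]_7) w k0 k1 k2 k3 k4 k5 k6 : M \in unitmx ->
  w = row7 k0 k1 k2 k3 k4 k5 k6 *m M -> w *m invmx M = row7 k0 k1 k2 k3 k4 k5 k6.
Proof. by move=> M_unit ->; rewrite mulmxK. Qed.

Lemma mx7_delta : mx7 (delta_mx 0 ixa) (delta_mx 0 ixb) (delta_mx 0 ixc)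
  (delta_mx 0 ixd) (delta_mx 0 ixe) (delta_mx 0 ixf) (delta_mx 0 ixg) = 1%:M :> 'M[R]_7.
Proof. by apply/matrixP; apply: ord7P; apply: ord7P; rewrite !mxE. Qed.

(** The basis generated by a and b in a structure nu near g6. *)
Definition c6 nu := lie_br nu a b.
Definition d6 nu := lie_br nu a (c6 nu).
Definition e6 nu := lie_br nu a (d6 nu).
Definition f6 nu := lie_br nu a (e6 nu).
Definition G6 nu := lie_br nu a (f6 nu).
Definition M6 nu := mx7 a b (c6 nu) (d6 nu) (e6 nu) (f6 nu) (G6 nu).
Definition bc6 nu := lie_br nu b (c6 nu) *m invmx (M6 nu).
Definition rho6 nu := (lie_br nu a (G6 nu) *m invmx (M6 nu)) 0 ixg.
(** The open conditions under which [structure6_sn], [structure6_nilpotent] and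
    [table6_normal] apply. *)
Definition adapted6 (r : R) nu :=
  [/\ M6 nu \in unitmx, lie_br nu (c6 nu) (d6 nu) != 0, 0 < bc6 nu 0 ixe,
      0 < bc6 nu 0 ixe + rho6 nu * (bc6 nu 0 ixf + rho6 nu * bc6 nu 0 ixg) &
      r != 0 -> rho6 nu != 0].

Lemma near_adapted6 r t : t != 0 -> \forall nu \near (g6 r t : tensor7 R), adapted6 r nu.
Proof.
move=> t0; set mu := g6 r t.
have M_cont : mx_cont_at mu M6 by cont_br.
have cE : c6 mu = delta_mx 0 ixc.
  by rewrite /c6 /a /b !delta_row7 g6_br; congr row7; ring.
have dE : d6 mu = delta_mx 0 ixd.
  by rewrite /d6 cE /a !delta_row7 g6_br; congr row7; ring.
have eE : e6 mu = delta_mx 0 ixe.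
  by rewrite /e6 dE /a !delta_row7 g6_br; congr row7; ring.
have fE : f6 mu = delta_mx 0 ixf.
  by rewrite /f6 eE /a !delta_row7 g6_br; congr row7; ring.
have gE : G6 mu = delta_mx 0 ixg.
  by rewrite /G6 fE /a !delta_row7 g6_br; congr row7; ring.
have ME : M6 mu = 1%:M by rewrite /M6 cE dE eE fE gE mx7_delta.
have M_unit : M6 mu \in unitmx by rewrite ME unitmx1.
have inv_cont := mx_cont_inv M_cont M_unit.
have bcE : bc6 mu = delta_mx 0 ixe.
  rewrite /bc6 ME invmx1 mulmx1 cE /b !delta_row7 g6_br; congr row7; ring.
have rhoE : rho6 mu = r.
  by rewrite /rho6 ME invmx1 mulmx1 gE /a !delta_row7 g6_br mxE /=; ring.
have bc_cont : mx_cont_at mu bc6 by apply: mx_contM => //; cont_br.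
have rho_cont : cont_at mu rho6.
  have : mx_cont_at mu (fun nu => lie_br nu a (G6 nu) *m invmx (M6 nu)).
    by apply: mx_contM => //; cont_br.
  exact.
have rho_near : \forall nu \near mu, r != 0 -> rho6 nu != 0.
  have [_|r0] := eqVneq r 0; first by near=> nu.
  have : \forall nu \near mu, rho6 nu != 0.
    by apply: (cont_at_neq0 rho_cont); rewrite rhoE.
  by apply: filterS.
have cd_cont : cont_at mu (fun nu => lie_br nu (c6 nu) (d6 nu) 0 ixg).
  have : mx_cont_at mu (fun nu => lie_br nu (c6 nu) (d6 nu)) by cont_br.
  exact.
near=> nu; split.
- by near: nu; exact: (near_unitmx M_cont M_unit).
- suff: lie_br nu (c6 nu) (d6 nu) 0 ixg != 0.
    by apply: contraNneq => ->; rewrite mxE.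
  near: nu; apply: (cont_at_neq0 cd_cont).
  by rewrite cE dE !delta_row7 g6_br mxE /= !mul0r mul1r !(subr0, mulr0, add0r) mulr1.
- near: nu; apply: (cont_at_gt0 (bc_cont 0 ixe)).
  by rewrite bcE mxE.
- near: nu; apply: (cont_at_gt0 (h := fun nu => bc6 nu 0 ixe + rho6 nu *
    (bc6 nu 0 ixf + rho6 nu * bc6 nu 0 ixg))).
    apply: cont_atD; first exact: bc_cont.
    apply: cont_atM => //; apply: cont_atD; first exact: bc_cont.
    by apply: cont_atM => //; exact: bc_cont.
  by rewrite bcE !mxE /= !(mulr0, addr0) ltr01.
- by near: nu; exact: rho_near.
Unshelve. all: by end_near.
Qed.

Lemma adapted6_sn r nu : r != 0 -> adapted6 r nu -> sn75_var nu ->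
  exists2 t, t != 0 & lie_isomorphic nu (g6 r t).
Proof.
move=> r0 [M_unit cd0 p_gt0 q_gt0 /(_ r0) rho0] sn.
have [be [p0 [p1 [p2 [s [ag bc [t t0 iso]]]]]]] :=
  structure6_sn sn.1 sn M_unit erefl erefl erefl erefl erefl cd0.
have bcE : bc6 nu = row7 0 0 0 be p0 p1 p2.
  apply: coord_mx7 => //; rewrite mulmx_row7 bc.
  by apply/rowP => i; rewrite !mxE; ring.
have rhoE : rho6 nu = s.
  rewrite /rho6 (@coord_mx7 _ _ 0 0 0 0 0 0 s M_unit) ?mxE // mulmx_row7 ag.
  by apply/rowP => i; rewrite !mxE; ring.
move: p_gt0 q_gt0 rho0; rewrite bcE rhoE !mxE /= => p_gt0 q_gt0 s0.
have [|t' t'0 iso'] := table6_normal (r0 := r) p_gt0 q_gt0 t0.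
  by rewrite (negbTE s0) (negbTE r0).
by exists t' => //; exact: lie_isomorphic_trans iso iso'.
Qed.

Lemma adapted6_nilpotent nu : adapted6 0 nu -> nilpotent_var nu ->
  exists2 t, t != 0 & lie_isomorphic nu (gI t).
Proof.
move=> [M_unit cd0 p_gt0 _ _] nil.
have [be [p0 [p1 [p2 [t [bc t0 iso]]]]]] :=
  structure6_nilpotent nil.1 nil M_unit erefl erefl erefl erefl erefl cd0.
have bcE : bc6 nu = row7 0 0 0 be p0 p1 p2.
  apply: coord_mx7 => //; rewrite mulmx_row7 bc.
  by apply/rowP => i; rewrite !mxE; ring.
move: p_gt0; rewrite bcE !mxE /= => p_gt0.
have [|//|t' t'0 iso'] :=
  table6_normal (r := 0) (r0 := 0) (p1 := p1) (p2 := p2) p_gt0 _ t0.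
  by rewrite mul0r addr0.
by exists t' => //; exact: lie_isomorphic_trans iso iso'.
Qed.

(** The basis generated by a and b in a structure nu near g5, with a corrected
    by the multiple eps5 of b. *)
Definition c5 nu := lie_br nu a b.
Definition e5 nu := lie_br nu b (c5 nu).
Definition G5 nu := lie_br nu (c5 nu) (e5 nu).
(** Chosen so that [c, h] has zero g-coordinate, as [structure5_sn] asks. *)
Definition eps5 nu := lie_br nu (c5 nu) (lie_br nu a (c5 nu)) 0 ixg / G5 nu 0 ixg.
Definition a5 nu := a - eps5 nu *: b.
Definition h5 nu := lie_br nu (a5 nu) (c5 nu).
Definition A5 nu := lie_br nu (a5 nu) (h5 nu).
Definition M5 nu := mx7 (a5 nu) b (c5 nu) (h5 nu) (e5 nu) (A5 nu) (G5 nu).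
(** The open conditions of [structure5_sn]. *)
Definition adapted5 nu :=
  [/\ M5 nu \in unitmx, G5 nu 0 ixg != 0,
    (lie_br nu b (e5 nu) *m invmx (M5 nu)) 0 ixd != 0,
    (lie_br nu (a5 nu) (e5 nu) *m invmx (M5 nu)) 0 ixg != 0 &
    0 < (lie_br nu (a5 nu) (A5 nu) *m invmx (M5 nu)) 0 ixg].

Lemma near_adapted5 r t : r != 0 -> 1 + t * r != 0 ->
  \forall nu \near (g5 r t : tensor7 R), adapted5 nu.
Proof.
move=> r0 k0; set mu := g5 r t; pose k := 1 + t * r.
have cE : c5 mu = row7 0 0 k 0 0 0 0.
  by rewrite /c5 /a /b !delta_row7 g5_br; congr row7; rewrite /k; ring.
have eE : e5 mu = row7 0 0 0 0 k 0 0.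
  by rewrite /e5 cE /b !delta_row7 g5_br; congr row7; ring.
have GE : G5 mu = row7 0 0 0 0 0 0 (k ^+ 2).
  by rewrite /G5 cE eE g5_br; congr row7; ring.
have epsE : eps5 mu = 0.
  have num0 : lie_br mu (c5 mu) (lie_br mu a (c5 mu)) 0 ixg = 0.
    by rewrite cE /a !delta_row7 !g5_br mxE /=; ring.
  by rewrite /eps5 num0 mul0r.
have aE : a5 mu = a by rewrite /a5 epsE scale0r subr0.
have hE : h5 mu = row7 0 0 0 k 0 0 0.
  by rewrite /h5 aE cE /a !delta_row7 g5_br; congr row7; ring.
have AE : A5 mu = row7 0 0 0 0 0 k (k * t).
  by rewrite /A5 aE hE /a !delta_row7 g5_br; congr row7; ring.
have M_unit : M5 mu \in unitmx.
  rewrite /M5 aE cE hE eE AE GE; apply: mx7_unit_upper.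
    by apply: ord7P; apply: ord7P => //; rewrite !mxE.
  by apply: ord7P; rewrite !mxE /= ?(mulf_neq0, expf_neq0, oner_neq0).
have G_neq0 : G5 mu 0 ixg != 0 by rewrite GE mxE /= expf_neq0.
have G_cont : mx_cont_at mu G5 by cont_br.
have a_cont : mx_cont_at mu a5.
  apply: mx_contD; first exact: mx_cont_cst.
  apply: mx_contN; apply: mx_contZ; last exact: mx_cont_cst.
  apply: cont_atM; last by apply: cont_atV => //; exact: G_cont.
  have : mx_cont_at mu (fun nu => lie_br nu (c5 nu) (lie_br nu a (c5 nu))) by cont_br.
  exact.
have h_cont : mx_cont_at mu h5 by apply: mx_cont_br => //; cont_br.
have A_cont : mx_cont_at mu A5 by apply: mx_cont_br.
have M_cont : mx_cont_at mu M5 by apply: mx_cont_mx7 => //; cont_br.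
have inv_cont := mx_cont_inv M_cont M_unit.
have be_cont : mx_cont_at mu (fun nu => lie_br nu b (e5 nu) *m invmx (M5 nu)).
  by apply: mx_contM => //; cont_br.
have ae_cont : mx_cont_at mu (fun nu => lie_br nu (a5 nu) (e5 nu) *m invmx (M5 nu)).
  by apply: mx_contM => //; apply: mx_cont_br => //; cont_br.
have aA_cont : mx_cont_at mu (fun nu => lie_br nu (a5 nu) (A5 nu) *m invmx (M5 nu)).
  by apply: mx_contM => //; apply: mx_cont_br.
near=> nu; split.
- by near: nu; exact: (near_unitmx M_cont M_unit).
- by near: nu; apply: (cont_at_neq0 (G_cont 0 ixg)).
- near: nu; apply: (cont_at_neq0 (be_cont 0 ixd)).
  rewrite (@coord_mx7 _ _ 0 0 0 r 0 1 (- t / k) M_unit) ?mxE //.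
  rewrite /M5 aE cE hE eE AE GE mulmx_row7 /a /b !delta_row7 g5_br !row7Z !row7D.
  by congr row7; (ring || by rewrite /k; field).
- near: nu; apply: (cont_at_neq0 (ae_cont 0 ixg)).
  rewrite (@coord_mx7 _ _ 0 0 0 0 0 0 k^-1 M_unit) ?mxE ?invr_neq0 //.
  rewrite /M5 aE cE hE eE AE GE mulmx_row7 /a /b !delta_row7 g5_br !row7Z !row7D.
  by congr row7; (ring || by rewrite /k; field).
- near: nu; apply: (cont_at_gt0 (aA_cont 0 ixg)).
  rewrite (@coord_mx7 _ _ 0 0 0 0 0 (- r) 1 M_unit) ?mxE ?ltr01 //.
  rewrite /M5 aE cE hE eE AE GE mulmx_row7 /a /b !delta_row7 g5_br !row7Z !row7D.
  by congr row7; (ring || by rewrite /k; field).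
Unshelve. all: by end_near.
Qed.

Lemma adapted5_sn r nu : r != 0 -> adapted5 nu -> sn75_var nu ->
  exists2 t, t != - 1 / r & lie_isomorphic nu (g5 r t).
Proof.
move=> r0 [M_unit G0 be0 ae0 aA0] sn.
have lie := sn.1.
have ab : lie_br nu (a5 nu) b = c5 nu.
  by rewrite /a5 !lie_brE lie.1 scaler0 subr0.
have ch : lie_br nu (c5 nu) (h5 nu) 0 ixg = 0.
  by rewrite /h5 /a5 !lie_brE -/(e5 nu) -/(G5 nu) !mxE /eps5 divfK ?subrr.
have [s [ga [q [s' [s0 ga0 q0 iso]]]]] :=
  structure5_sn lie sn M_unit ab erefl erefl erefl erefl ch G0 be0 ae0 aA0.
have [t t0 iso'] := table5_normal s' s0 r0 ga0 q0.
by exists t => //; exact: lie_isomorphic_trans iso iso'.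
Qed.

(** The basis generated by a and b in a structure nu near g1, and the
    coordinates that are the parameters of [table1]. *)
Definition d1 nu := lie_br nu a (c5 nu).
Definition f1 nu := lie_br nu b (e5 nu).
Definition M1 nu := mx7 a b (c5 nu) (d1 nu) (e5 nu) (f1 nu) (G5 nu).
Definition ad1 nu := lie_br nu a (d1 nu) *m invmx (M1 nu).
Definition ae1 nu := lie_br nu a (e5 nu) *m invmx (M1 nu).
Definition s1 nu := (lie_br nu b (f1 nu) *m invmx (M1 nu)) 0 ixg.
Definition rho1 nu := 1 + ae1 nu 0 ixf * s1 nu.
Definition k1 nu := s1 nu / rho1 nu.
(** The open conditions of [structure5_nilpotent] and [table1_normal]. *)
Definition adapted1 nu :=
  [/\ M1 nu \in unitmx,
    [/\ 0 < lie_br nu a (lie_br nu a (d1 nu)) 0 ixg, 0 < lie_br nu a (f1 nu) 0 ixg &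
      0 < lie_br nu a (lie_br nu a (d1 nu)) 0 ixg * lie_br nu a (f1 nu) 0 ixg -
        (lie_br nu a (lie_br nu a (e5 nu)) 0 ixg) ^+ 2],
    rho1 nu != 0, 0 < ad1 nu 0 ixf - ae1 nu 0 ixf ^+ 2 &
    (ae1 nu 0 ixg - k1 nu * ad1 nu 0 ixg) *
      (1 - 2 * k1 nu * ae1 nu 0 ixf + k1 nu ^+ 2 * ad1 nu 0 ixf) -
    (ae1 nu 0 ixf - k1 nu * ad1 nu 0 ixf) *
      (k1 nu ^+ 2 * ad1 nu 0 ixg - 2 * k1 nu * ae1 nu 0 ixg) != 0].

Lemma near_adapted1 la : \forall nu \near (g1 la : tensor7 R), adapted1 nu.
Proof.
set mu := g1 la.
have g1_br := g5_br 0 la.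
have cE : c5 mu = delta_mx 0 ixc.
  by rewrite /c5 /a /b !delta_row7 g1_br; congr row7; ring.
have dE : d1 mu = delta_mx 0 ixd.
  by rewrite /d1 cE /a !delta_row7 g1_br; congr row7; ring.
have eE : e5 mu = delta_mx 0 ixe.
  by rewrite /e5 cE /b !delta_row7 g1_br; congr row7; ring.
have fE : f1 mu = delta_mx 0 ixf.
  by rewrite /f1 eE /b !delta_row7 g1_br; congr row7; ring.
have GE : G5 mu = delta_mx 0 ixg.
  by rewrite /G5 cE eE !delta_row7 g1_br; congr row7; ring.
have ME : M1 mu = 1%:M by rewrite /M1 cE dE eE fE GE mx7_delta.
have M_unit : M1 mu \in unitmx by rewrite ME unitmx1.
have M_cont : mx_cont_at mu M1 by cont_br.
have inv_cont := mx_cont_inv M_cont M_unit.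
have adE : ad1 mu = row7 0 0 0 0 0 1 la.
  by rewrite /ad1 ME invmx1 mulmx1 dE /a !delta_row7 g1_br; congr row7; ring.
have aeE : ae1 mu = row7 0 0 0 0 0 0 1.
  by rewrite /ae1 ME invmx1 mulmx1 eE /a !delta_row7 g1_br; congr row7; ring.
have sE : s1 mu = 0.
  by rewrite /s1 ME invmx1 mulmx1 fE /b !delta_row7 g1_br mxE /=; ring.
have rhoE : rho1 mu = 1 by rewrite /rho1 sE mulr0 addr0.
have kE : k1 mu = 0 by rewrite /k1 sE mul0r.
have ad_cont : mx_cont_at mu ad1 by apply: mx_contM => //; cont_br.
have ae_cont : mx_cont_at mu ae1 by apply: mx_contM => //; cont_br.
have s_cont : cont_at mu s1.
  have : mx_cont_at mu (fun nu => lie_br nu b (f1 nu) *m invmx (M1 nu)).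
    by apply: mx_contM => //; cont_br.
  exact.
have rho_cont : cont_at mu rho1.
  apply: cont_atD; first exact: cont_at_cst.
  by apply: cont_atM => //; exact: ae_cont.
have rho0 : rho1 mu != 0 by rewrite rhoE oner_neq0.
have k_cont : cont_at mu k1 by apply: cont_atM => //; exact: cont_atV.
have x_cont : mx_cont_at mu (fun nu => lie_br nu a (lie_br nu a (d1 nu))) by cont_br.
have y_cont : mx_cont_at mu (fun nu => lie_br nu a (lie_br nu a (e5 nu))) by cont_br.
have z_cont : mx_cont_at mu (fun nu => lie_br nu a (f1 nu)) by cont_br.
have xE : lie_br mu a (lie_br mu a (d1 mu)) = row7 0 0 0 0 0 0 1.
  by rewrite dE /a !delta_row7 !g1_br; congr row7; ring.
have yE : lie_br mu a (lie_br mu a (e5 mu)) = 0.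
  by rewrite eE /a !delta_row7 !g1_br; apply/rowP; apply: ord7P; rewrite !mxE /=; ring.
have zE : lie_br mu a (f1 mu) = row7 0 0 0 0 0 0 1.
  by rewrite fE /a !delta_row7 !g1_br; congr row7; ring.
near=> nu; split; first by near: nu; exact: (near_unitmx M_cont M_unit).
- split.
  + by near: nu; apply: (cont_at_gt0 (x_cont 0 ixg)); rewrite xE mxE ltr01.
  + by near: nu; apply: (cont_at_gt0 (z_cont 0 ixg)); rewrite zE mxE ltr01.
  near: nu; apply: (cont_at_gt0 (h := fun nu =>
    lie_br nu a (lie_br nu a (d1 nu)) 0 ixg * lie_br nu a (f1 nu) 0 ixg -
    (lie_br nu a (lie_br nu a (e5 nu)) 0 ixg) ^+ 2)).
    apply: cont_atD; first by apply: cont_atM; [exact: x_cont | exact: z_cont].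
    by apply: cont_atN; apply: cont_atM; exact: y_cont.
  by rewrite xE yE zE !mxE /= mulr1 expr0n subr0 ltr01.
- by near: nu; exact: (cont_at_neq0 rho_cont rho0).
- near: nu; apply: (cont_at_gt0 (h := fun nu => ad1 nu 0 ixf - ae1 nu 0 ixf ^+ 2)).
    apply: cont_atD; first exact: ad_cont.
    by apply: cont_atN; apply: cont_atM; exact: ae_cont.
  by rewrite adE aeE !mxE /= expr0n subr0 ltr01.
near: nu; apply: (cont_at_neq0 (h := fun nu =>
    (ae1 nu 0 ixg - k1 nu * ad1 nu 0 ixg) *
      (1 - 2 * k1 nu * ae1 nu 0 ixf + k1 nu ^+ 2 * ad1 nu 0 ixf) -
    (ae1 nu 0 ixf - k1 nu * ad1 nu 0 ixf) *
      (k1 nu ^+ 2 * ad1 nu 0 ixg - 2 * k1 nu * ae1 nu 0 ixg))).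
  have adf := ad_cont 0 ixf; have adg := ad_cont 0 ixg.
  have aef := ae_cont 0 ixf; have aeg := ae_cont 0 ixg.
  have kk := cont_atM k_cont k_cont.
  have cst x : cont_at mu (fun=> x : R) by exact: cont_at_cst.
  have k2 := cont_atM (cst 2) k_cont.
  apply: cont_atD; [|apply: cont_atN]; apply: cont_atM.
  - exact: (cont_atD aeg (cont_atN (cont_atM k_cont adg))).
  - exact: (cont_atD (cont_atD (cst 1) (cont_atN (cont_atM k2 aef)))
      (cont_atM kk adf)).
  - exact: (cont_atD aef (cont_atN (cont_atM k_cont adf))).
  - exact: (cont_atD (cont_atM kk adg) (cont_atN (cont_atM k2 aeg))).
rewrite kE adE aeE !mxE /=.
by rewrite !(mul0r, mulr0, expr0n, subr0, addr0, mul1r) oner_neq0.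
Unshelve. all: by end_near.
Qed.

Lemma adapted1_nilpotent nu : adapted1 nu -> nilpotent_var nu ->
  exists t, lie_isomorphic nu (g1 t).
Proof.
move=> [M_unit [x0 z0 disc] rho0 al0 det0] nil.
rewrite subr_gt0 in disc.
have [a1 [a2 [b1 [b2 [s [ad ae bf iso]]]]]] :=
  structure5_nilpotent nil M_unit erefl erefl erefl erefl erefl x0 z0 disc.
have adE : ad1 nu = row7 0 0 0 0 0 a1 a2.
  apply: coord_mx7 => //; rewrite mulmx_row7 ad.
  by apply/rowP => i; rewrite !mxE; ring.
have aeE : ae1 nu = row7 0 0 0 0 0 b1 b2.
  apply: coord_mx7 => //; rewrite mulmx_row7 ae.
  by apply/rowP => i; rewrite !mxE; ring.
have sE : s1 nu = s.
  rewrite /s1 (@coord_mx7 _ _ 0 0 0 0 0 0 s M_unit) ?mxE // mulmx_row7 bf.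
  by apply/rowP => i; rewrite !mxE; ring.
move: rho0 al0 det0; rewrite /k1 /rho1 adE aeE sE !mxE /= => rho0 al0 det0.
have [||t iso'] := table1_normal (a1 := a1) (a2 := a2) (b2 := b2) rho0.
- by rewrite -subr_gt0.
- by rewrite -subr_eq0.
by exists t; exact: lie_isomorphic_trans iso iso'.
Qed.

End NearbyStructures.

Theorem proposition4p1 (R : realType) :
  (rigid_curve nilpotent_var [set: R] g1 /\
   rigid_curve nilpotent_var [set alpha : R | alpha != 0] gI) /\
  (forall r0 : R, r0 != 0 ->
     rigid_curve sn75_var [set t : R | t != - 1 / r0] (g5 r0) /\
     rigid_curve sn75_var [set t : R | t != 0] (g6 r0)).
Proof.
split; first split.
- split=> [||t _|t _]; first exact: openT.
  + exact/continuous_subspaceT/g5_continuous.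
  + exact: g1_nilpotent.
  + rewrite near_withinE; have := near_adapted1 t; apply: filterS => nu good nil.
    by have [s iso] := adapted1_nilpotent good nil; exists s.
- split=> [||t _|t t0]; first exact: open_neq.
  + exact/continuous_subspaceT/g6_continuous.
  + exact: gI_nilpotent.
  + rewrite near_withinE; have := near_adapted6 0 t0; apply: filterS => nu good nil.
    exact: adapted6_nilpotent.
move=> r r0; split.
- split=> [||t _|t t0]; first exact: open_neq.
  + exact/continuous_subspaceT/g5_continuous.
  + exact: g5_sn.
  + have tr0 : 1 + t * r != 0.
      apply: contra_neq t0 => tr; apply: (mulIf r0); rewrite divfK //.
      by apply/eqP; rewrite -subr_eq0 opprK addrC tr.
    rewrite near_withinE; have := near_adapted5 r0 tr0; apply: filterS => nu good sn.
    exact: adapted5_sn.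
- split=> [||t _|t t0]; first exact: open_neq.
  + exact/continuous_subspaceT/g6_continuous.
  + exact: g6_sn.
  + rewrite near_withinE; have := near_adapted6 r t0; apply: filterS => nu good sn.
    exact: adapted6_sn.
Qed.
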